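(* Assume the Setting (S) described in the context. Then for every integer $n\ge 0$, $$\frac{1}{2\pi}\int_D \Omega_n\,dx\,dy=\mathcal C,\qquad \frac{1}{2\pi}\int_D \operatorname{Tr} g_n\,dx\,dy=(2n+1)\,\frac{1}{2\pi}\int_D \Omega_n\,dx\,dy=(2n+1)\,\mathcal C .$$
   Context: Setting (S). Let $\mathcal H$ be a separable complex Hilbert space with inner product $\langle\cdot|\cdot\rangle$, antilinear in the first slot. Let $\Lambda\subset\mathbb C$ be a lattice with fundamental domain $D$. Write $z=x+iy$, $\partial=\tfrac12(\partial_x-i\partial_y)$, $\bar\partial=\tfrac12(\partial_x+i\partial_y)$. Let $f:\mathbb C\to\mathcal H$ be holomorphic and satisfy: (i) for every $z\in\mathbb C$ and every $n\ge0$ the vectors $f(z),\partial f(z),\dots,\partial^n f(z)$ are linearly independent; (ii) for every $\lambda\in\Lambda$ there are a nowhere-vanishing holomorphic function $c_\lambda:\mathbb C\to\mathbb C$ and a unitary operator $V_\lambda$ on $\mathcal H$ independent of $z$ such that $f(z+\lambda)=c_\lambda(z)V_\lambda f(z)$ for all $z$. For $n\ge0$ let $P_n(z)$ be the orthogonal projector onto $\mathrm{span}\{f(z),\partial f(z),\dots,\partial^{n-1}f(z)\}$ (with $P_0=0$), let $r_n=\|(1-P_n)\partial^n f\|>0$ and define the ''generalized Landau levels'' $u_n=(1-P_n)\partial^n f/r_n$ (so $(u_n)_{n\ge0}$ is the Gram–Schmidt orthonormalization of $f,\partial f,\partial^2 f,\dots$; $u_0=f/\|f\|$). For a smooth unit-vector-valued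 map $u$ of $(x,y)$ define the quantum geometric tensor $\chi_{ab}=\langle\partial_a u|(1-|u\rangle\langle u|)|\partial_b u\rangle$ for $a,b\in\{x,y\}$, the quantum metric $g_{ab}=\operatorname{Re}\chi_{ab}$, its trace $\operatorname{Tr} g=g_{xx}+g_{yy}$, and the Berry curvature $\Omega=2\operatorname{Im}\chi_{xy}$. Write $g_n,\Omega_n$ for these quantities computed from $u=u_n$ (they are $\Lambda$-periodic functions). The Chern number is $\mathcal C=\frac1{2\pi}\int_D\Omega_0\,dx\,dy$. *)

(* Defs.v *)
From HB Require Import structures.
From mathcomp Require Import all_boot all_order all_algebra.
From mathcomp Require Import all_classical all_reals all_analysis.
From mathcomp Require Import complex.
Import Order.TTheory GRing.Theory Num.Theory.
Import numFieldNormedType.Exports.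

Set Implicit Arguments.
Unset Strict Implicit.
Unset Printing Implicit Defensive.

Local Open Scope ring_scope.
Local Open Scope classical_set_scope.

Section Defs.
Context {R : realType}.

Definition toC (p : R * R) : R[i] := Complex p.1 p.2.

Definition iC : R[i] := Complex 0 1.

(* lattice Lambda = Z w1 + Z w2, with w1, w2 R-linearly independent *)
Definition lattice_basis (w1 w2 : R[i]) : Prop := complex.Im (conjc w1 * w2) != 0.
Definition lattice (w1 w2 : R[i]) : set R[i] :=
  [set z | exists m k : int, z = m%:~R * w1 + k%:~R * w2].

Definition fundamental_domain (L : set R[i]) (D : set (R * R)) : Prop :=
  measurable D /\ forall z : R[i], exists! p, D p /\ L (z - toC p).

Definition holomorphic {V : normedModType R[i]} (f : R[i]^o -> V) : Prop :=
  forall z, derivable f z 1.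

Context {H : normedModType R[i]}.

Definition inner_product (ip : H -> H -> R[i]) : Prop :=
  [/\ forall a u v w, ip (a *: u + v) w = conjc a * ip u w + ip v w,
      forall u v, ip u v = conjc (ip v u) &
      forall v, ip v v = `|v| ^+ 2].

Definition separable_space : Prop :=
  exists S : set H, countable S /\ closure S = setT.

Definition unitary (ip : H -> H -> R[i]) (V : H -> H) : Prop :=
  [/\ forall a u v, V (a *: u + v) = a *: V u + V v,
      forall u v, ip (V u) (V v) = ip u v &
      forall w, exists v, V v = w].

Definition dn (f : R[i]^o -> H) (n : nat) (z : R[i]) : H := derive1n n f z.

Definition derivs_independent (f : R[i]^o -> H) : Prop :=
  forall (z : R[i]) (n : nat) (c : 'I_n.+1 -> R[i]),
    \sum_(k < n.+1) c k *: dn f k z = 0 -> forall k, c k = 0.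

Definition quasi_periodic (ip : H -> H -> R[i]) (L : set R[i])
  (f : R[i]^o -> H) : Prop :=
  forall l, L l ->
    exists c : R[i]^o -> R[i]^o, holomorphic c /\ (forall z, c z != 0) /\
    exists V : H -> H, unitary ip V /\ forall z, f (z + l) = c z *: V (f z).

Definition in_span (vs : nat -> H) (n : nat) (w : H) : Prop :=
  exists c : 'I_n -> R[i], w = \sum_(k < n) c k *: vs k.

Definition orth_proj (ip : H -> H -> R[i]) (vs : nat -> H) (n : nat) (v : H) : H :=
  xget 0 [set w | in_span vs n w /\
                  forall k, (k < n)%N -> ip (vs k) (v - w) = 0].

Definition Pn (ip : H -> H -> R[i]) (f : R[i]^o -> H) (n : nat) (z : R[i]) : H -> H :=
  orth_proj ip (fun k => dn f k z) n.

Definition rn ip f n z : R[i] := `| dn f n z - Pn ip f n z (dn f n z) |.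
Definition LL ip f (n : nat) (z : R[i]) : H :=
  (rn ip f n z)^-1 *: (dn f n z - Pn ip f n z (dn f n z)).

(* real partial derivative of u : C -> H in direction d (d = 1: ∂_x, d = i: ∂_y) *)
Definition pd (d : R[i]) (u : R[i] -> H) (z : R[i]) : H :=
  lim ((fun t : R => (t%:C)%C^-1 *: (u (z + (t%:C)%C * d) - u z)) @ 0^').

(* quantum geometric tensor chi_ab = <∂_a u | (1 - |u><u|) | ∂_b u> *)
Definition qgt ip (u : R[i] -> H) (da db : R[i]) (z : R[i]) : R[i] :=
  ip (pd da u z) (pd db u z - ip (u z) (pd db u z) *: u z).

Definition trace_metric ip (u : R[i] -> H) (z : R[i]) : R :=
  complex.Re (qgt ip u 1 1 z) + complex.Re (qgt ip u iC iC z).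
Definition berry ip (u : R[i] -> H) (z : R[i]) : R :=
  2 * complex.Im (qgt ip u 1 iC z).

End Defs.

Definition intD {R : realType} (D : set (R * R)) (F : R[i] -> R) : \bar R :=
  (\int[(@lebesgue_measure R \x @lebesgue_measure R)%E]_(p in D) (F (toC p))%:E)%E.

(* Main.v *)
Require Import Defs.
From HB Require Import structures.
From mathcomp Require Import all_boot all_order all_algebra.
From mathcomp Require Import all_classical all_reals all_analysis.
From mathcomp Require Import complex.
From mathcomp Require Import measurable_realfun.
From mathcomp Require Import ring lra.
Import Order.TTheory GRing.Theory Num.Theory.
Import numFieldNormedType.Exports.
Local Open Scope ring_scope.
Local Open Scope classical_set_scope.

Set Implicit Arguments.
Unset Strict Implicit.
Unset Printing Implicit Defensive.

(* Let v_n = (1 - P_n) d^n f be the unnormalised Gram-Schmidt frame. Since f is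
   holomorphic, differentiating the orthogonality relations gives
     d v_n = v_{n+1} + b_n v_n   and   dbar v_n = - a_{n-1} v_{n-1},
   with a_n = |v_{n+1}|^2 / |v_n|^2 and a_{-1} = 0. For the normalised u_n this yields
     Tr g_n = 2 (a_n + a_{n-1})   and   Omega_n = 2 (a_n - a_{n-1}).
   The subdiagonal entry l_n = <v_n | d^{n+1} f> / |v_n|^2 satisfies
   dbar l_n = a_n, and under a lattice translation it changes by
   (n + 1) c'/c. Hence l_n - (n + 1) l_0 is periodic, its dbar derivative
   a_n - (n + 1) a_0 has integral 0 over D, and the integral of a_n is n + 1 times
   that of a_0. *)

(** Two restrictions shape the proof. D is any measurable fundamental domain, without boundary
    regularity, so Stokes' theorem is replaced by translation invariance: difference quotients of a
    periodic function integrate to 0, and a bounded limit preserves this. And holomorphy is given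
    only as complex differentiability of f itself; that every iterated derivative is again
    differentiable is extracted from the linear independence of the derivatives and the default
    value of limits.

    The choice of l_n has a simple origin. Since v_n is orthogonal to v_{n+1} and to dbar v_n, b_n =
    d log |v_n|^2; moreover b_n = l_n - l_{n-1}, so l_n is d log of the Gram determinant |v_0|^2 ...
    |v_n|^2. Each |v_k|^2 is multiplied by |c|^2 under a translation, which explains the n + 1
    copies of c'/c. Working with l_n instead of the logarithm keeps the computation at first order:
    a_n is the dbar derivative of a quotient of inner products, and no mixed second derivative is
    taken. *)

Section InnerProduct.
Context {K : numClosedFieldType} {V : normedModType K} (ip : V -> V -> K).
Hypothesis ipl : forall a u v w, ip (a *: u + v) w = a^* * ip u w + ip v w.
Hypothesis ipC : forall u v, ip u v = (ip v u)^*.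
Hypothesis ipn : forall v, ip v v = `|v| ^+ 2.

Lemma ip0l w : ip 0 w = 0.
Proof.
have := ipl 1 0 0 w; rewrite rmorph1 mul1r scaler0 addr0 => /eqP.
by rewrite -subr_eq subrr eq_sym => /eqP.
Qed.

Lemma ipDl u v w : ip (u + v) w = ip u w + ip v w.
Proof. by rewrite -[u in LHS]scale1r ipl rmorph1 mul1r. Qed.

Lemma ipZl a u w : ip (a *: u) w = a^* * ip u w.
Proof. by rewrite -[_ *: _]addr0 ipl ip0l addr0. Qed.

Lemma ip0r w : ip w 0 = 0.
Proof. by rewrite ipC ip0l rmorph0. Qed.

Lemma ipDr u v w : ip w (u + v) = ip w u + ip w v.
Proof. by rewrite ipC ipDl rmorphD (ipC w u) (ipC w v). Qed.

Lemma ipZr a u w : ip w (a *: u) = a * ip w u.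
Proof. by rewrite ipC ipZl rmorphM /= conjCK (ipC w u). Qed.

Lemma ipNl u w : ip (- u) w = - ip u w.
Proof. by rewrite -scaleN1r ipZl rmorphN rmorph1 mulN1r. Qed.

Lemma ipNr u w : ip w (- u) = - ip w u.
Proof. by rewrite -scaleN1r ipZr mulN1r. Qed.

Lemma ipBl u v w : ip (u - v) w = ip u w - ip v w.
Proof. by rewrite ipDl ipNl. Qed.

Lemma ipBr u v w : ip w (u - v) = ip w u - ip w v.
Proof. by rewrite ipDr ipNr. Qed.

Lemma ip_suml I (r : seq I) (P : pred I) (F : I -> V) w :
  ip (\sum_(i <- r | P i) F i) w = \sum_(i <- r | P i) ip (F i) w.
Proof. by elim/big_rec2: _ => [|i y x _ <-]; rewrite ?ip0l ?ipDl. Qed.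

Lemma ip_sumr I (r : seq I) (P : pred I) (F : I -> V) w :
  ip w (\sum_(i <- r | P i) F i) = \sum_(i <- r | P i) ip w (F i).
Proof. by elim/big_rec2: _ => [|i y x _ <-]; rewrite ?ip0r ?ipDr. Qed.

Lemma ip_gt0 v : v != 0 -> 0 < ip v v.
Proof. by move=> v0; rewrite ipn exprn_gt0 // normr_gt0. Qed.

Lemma ip_eq0 v : ip v v = 0 -> v = 0.
Proof. by rewrite ipn => /eqP; rewrite expf_eq0 /= normr_eq0 => /eqP. Qed.

Lemma CauchySchwarz u v : `|ip u v| <= `|u| * `|v|.
Proof.
have [->|v0] := eqVneq v 0; first by rewrite ip0r !normr0 mulr0.
have vv : ip v v != 0 by rewrite gt_eqF ?ip_gt0.
rewrite -(ler_pXn2r (n := 2)) ?nnegrE ?mulr_ge0 //.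
(* This vector is |v|^2 times the component of [u] orthogonal to [v]; its squared norm is |v|^2
   (|u|^2 |v|^2 - |<u|v>|^2). *)
have : 0 <= ip (ip v v *: u - ip v u *: v) (ip v v *: u - ip v u *: v).
  by rewrite ipn exprn_ge0.
have rv : (ip v v)^* = ip v v by rewrite -ipC.
rewrite ipBl !ipBr !ipZl !ipZr -(ipC u v) rv.
have -> : ip v v * (ip v v * ip u u) - ip v v * (ip v u * ip u v)
  - (ip u v * (ip v v * ip v u) - ip u v * (ip v u * ip v v))
  = ip v v * (ip u u * ip v v - ip u v * ip v u) by ring.
rewrite pmulr_rge0 ?ip_gt0 // subr_ge0 !ipn -exprMn (ipC v u).
by rewrite -normCK.
Qed.

(** Continuity is not part of the axioms of [ip]; it follows from Cauchy-Schwarz through <u|v> -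
    <a|b> = <u - a|v> + <a|v - b>. *)
Lemma cvg_ip (T : Type) (F : set_system T) (FF : Filter F) (u v : T -> V) a b :
  u x @[x --> F] --> a -> v x @[x --> F] --> b ->
  ip (u x) (v x) @[x --> F] --> ip a b.
Proof.
move=> ua vb; apply/subr_cvg0/norm_cvg0P.
have bound x : `|ip (u x) (v x) - ip a b|
    <= `|u x - a| * `|v x| + `|a| * `|v x - b|.
  have -> : ip (u x) (v x) - ip a b = ip (u x - a) (v x) + ip a (v x - b).
    by rewrite ipBl ipBr addrA subrK.
  by rewrite (le_trans (ler_normD _ _))// lerD // CauchySchwarz.
have lim0 : `|u x - a| * `|v x| + `|a| * `|v x - b| @[x --> F] --> (0 : K).
  rewrite -[X in _ --> X]addr0 -[X in _ --> X + _](mul0r `|b|).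
  rewrite -[X in _ --> _ + X](mulr0 `|a|).
  apply: cvgD; apply: cvgM; [|exact: cvg_norm|exact: cvg_cst|].
    by rewrite -[X in _ --> X](@normr0 _ V); apply: cvg_norm; apply/subr_cvg0.
  by rewrite -[X in _ --> X](@normr0 _ V); apply: cvg_norm; apply/subr_cvg0.
apply/(@cvgr0Pnorm_le K K _ F) => e e0.
have /(@cvgr0Pnorm_le K K _ F) /(_ _ e0) := lim0.
apply: filterS => x; rewrite normr_id; apply: le_trans.
by rewrite [leRHS]ger0_norm; [exact: bound|rewrite addr_ge0 // mulr_ge0].
Qed.
End InnerProduct.

(** * Wirtinger derivatives *)

Section Wirtinger.
Context {K : numClosedFieldType}.
Implicit Types (V : normedModType K).

Definition nbhs0 : set_system K := nbhs (0 : K^o).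

Global Instance nbhs0_filter : Filter nbhs0 := nbhs_filter (0 : K^o).

(* Caratheodory form of [u (z + h) = u z + h A + conj h B + o(h)], so that A
   and B are the Wirtinger derivatives of u at z. *)
Definition wirtinger V (u : K -> V) (z : K) (A B : V) :=
  exists a b : K -> V, [/\ a h @[h --> nbhs0] --> A, b h @[h --> nbhs0] --> B &
    forall h, u (z + h) = u z + h *: a h + h^* *: b h].

Lemma cvg_conjC (T : Type) (F : set_system T) (FF : Filter F) (u : T -> K) (a : K) :
  u x @[x --> F] --> a -> (u x)^* @[x --> F] --> a^*.
Proof.
move=> /(@cvgrPdist_le K K _ F) ua; apply/(@cvgrPdist_le K K _ F) => e e0.
by apply: filterS (ua _ e0) => x; rewrite -rmorphB norm_conjC.
Qed.

Lemma cvg_id0 : h @[h --> nbhs0] --> (0 : K).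
Proof. exact: (@cvg_id _ (nbhs (0 : K^o))). Qed.

Lemma cvg_conjC0 : h^* @[h --> nbhs0] --> (0 : K).
Proof. by rewrite -conjC0; apply: cvg_conjC; exact: cvg_id0. Qed.

Lemma wirtinger_cvg0 V (u : K -> V) z A B :
  wirtinger u z A B -> u (z + h) @[h --> nbhs0] --> u z.
Proof.
case=> a [b [ca cb uE]].
have -> : (fun h => u (z + h)) = (fun h => u z + h *: a h + h^* *: b h).
  by apply/funext => h; rewrite uE.
rewrite -[X in _ --> X]addr0 -[X in _ --> X + _]addr0.
apply: cvgD; first apply: cvgD; first exact: cvg_cst.
  by rewrite -(scale0r A); apply: cvgZ => //; exact: cvg_id0.
by rewrite -(scale0r B); apply: cvgZ => //; exact: cvg_conjC0.
Qed.

Lemma wirtinger_continuous V (u : K -> V) z A B :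
  wirtinger u z A B -> {for z, continuous (u : K^o -> V)}.
Proof.
move=> /wirtinger_cvg0 uz; rewrite (@continuous_shift _ K^o).
rewrite /prop_for /continuous_at /= add0r.
by apply: cvg_trans uz; apply: near_eq_cvg; apply: nearW => h /=; rewrite addrC.
Qed.

Lemma wirtinger_cst V (v : V) z : wirtinger (fun=> v) z 0 0.
Proof.
exists (fun=> 0), (fun=> 0); split; [exact: cvg_cst|exact: cvg_cst|].
by move=> h; rewrite !scaler0 !addr0.
Qed.

Lemma wirtingerD V (u v : K -> V) z A B A' B' :
  wirtinger u z A B -> wirtinger v z A' B' ->
  wirtinger (fun z => u z + v z) z (A + A') (B + B').
Proof.
case=> a [b [ca cb uE]] [a' [b' [ca' cb' vE]]].
exists (fun h => a h + a' h), (fun h => b h + b' h).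
split; [exact: cvgD|exact: cvgD|] => h.
rewrite uE vE !scalerDr; set x := h *: _; set y := h^* *: _.
by rewrite addrACA; congr (_ + _); rewrite addrACA.
Qed.

Lemma wirtingerZ V (c : K -> K) (u : K -> V) z (c1 c2 : K) A B :
  wirtinger (V := K^o) c z c1 c2 -> wirtinger u z A B ->
  wirtinger (fun z => c z *: u z) z (c1 *: u z + c z *: A) (c2 *: u z + c z *: B).
Proof.
move=> [a [b [ca cb cE]]] wu; have cu := wirtinger_cvg0 wu.
case: wu => a' [b' [ca' cb' uE]].
(* The increment is split as (c (z + h) - c z) u (z + h) + c z (u (z + h) - u z), so the first
   quotient carries [u] at the shifted point and converges by continuity of [u] at z. *)
exists (fun h => a h *: u (z + h) + c z *: a' h),
  (fun h => b h *: u (z + h) + c z *: b' h); split.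
- by apply: cvgD; apply: cvgZ => //; exact: cvg_cst.
- by apply: cvgD; apply: cvgZ => //; exact: cvg_cst.
move=> h; rewrite cE 2!scalerDl [in RHS]scalerDr [X in _ = _ + X]scalerDr.
rewrite {1}uE !scalerDr !scalerA [h * c z]mulrC [h^* * c z]mulrC.
rewrite -!scalerA -!addrA; congr (_ + _).
by rewrite [RHS]addrCA; congr (_ + _); rewrite [RHS]addrA [RHS]addrC.
Qed.

Lemma wirtingerZl V (k : K) (u : K -> V) z A B :
  wirtinger u z A B -> wirtinger (fun z => k *: u z) z (k *: A) (k *: B).
Proof.
move=> /(wirtingerZ (wirtinger_cst (k : K^o) z)).
by rewrite !scale0r !add0r.
Qed.

Lemma wirtingerB V (u v : K -> V) z A B A' B' :
  wirtinger u z A B -> wirtinger v z A' B' ->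
  wirtinger (fun z => u z - v z) z (A - A') (B - B').
Proof.
move=> wu /(wirtingerZl (-1)); rewrite !scaleN1r => /(wirtingerD wu).
by congr wirtinger; apply/funext => x; rewrite scaleN1r.
Qed.

Lemma wirtingerM (c d : K -> K) z (c1 c2 d1 d2 : K) :
  wirtinger (V := K^o) c z c1 c2 -> wirtinger (V := K^o) d z d1 d2 ->
  wirtinger (V := K^o) (fun z => c z * d z) z
    (c1 * d z + c z * d1) (c2 * d z + c z * d2).
Proof. exact: wirtingerZ. Qed.

Lemma wirtinger_sum V n (F : 'I_n -> K -> V) z A B :
  (forall i, wirtinger (F i) z (A i) (B i)) ->
  wirtinger (fun z => \sum_(i < n) F i z) z (\sum_(i < n) A i) (\sum_(i < n) B i).
Proof.
elim: n F A B => [|n IH] F A B wF.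
  rewrite !big_ord0 [X in wirtinger X](_ : _ = fun=> 0); first exact: wirtinger_cst.
  by apply/funext => x; rewrite big_ord0.
rewrite !big_ord_recr [X in wirtinger X](_ : _ = fun x =>
    \sum_(i < n) F (widen_ord (leqnSn n) i) x + F ord_max x); last first.
  by apply/funext => x; rewrite big_ord_recr.
by apply: wirtingerD => //; apply: IH => i.
Qed.

Lemma wirtingerV (c : K -> K) z (c1 c2 : K) : (forall z, c z != 0) ->
  wirtinger (V := K^o) c z c1 c2 ->
  wirtinger (V := K^o) (fun z => (c z)^-1) z (- c1 / c z ^+ 2) (- c2 / c z ^+ 2).
Proof.
move=> c0 wc; have cc := wirtinger_cvg0 wc; case: wc => [a [b [ca cb cE]]].
have cV : (c z)^-1 * (c (z + h))^-1 @[h --> nbhs0] --> (c z)^-1 ^+ 2.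
  by rewrite expr2; apply: cvgM; [exact: cvg_cst|exact: cvgV].
exists (fun h => - a h * ((c z)^-1 * (c (z + h))^-1)),
  (fun h => - b h * ((c z)^-1 * (c (z + h))^-1)); split.
- by rewrite -exprVn; apply: cvgM => //; exact: cvgN.
- by rewrite -exprVn; apply: cvgM => //; exact: cvgN.
move=> h; have := cE h; have := c0 z; have := c0 (z + h).
move: (c (z + h)) (c z) (a h : K) (b h : K) => x y.
change K^o with (K : Type) => p q x0 y0.
have scE (k w : K) : k *: (w : K^o) = k * w by [].
rewrite !scE => E.
have -> : y^-1 + h * (- p * (y^-1 / x)) + h^* * (- q * (y^-1 / x))
  = (x - (h * p + h^* * q)) / (x * y).
  by field; rewrite x0 y0.
have -> : x - (h * p + h^* * q) = y by rewrite E; ring.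
by field; rewrite x0 y0.
Qed.

Lemma wirtinger_derivable V (f : K^o -> V) z : derivable f z 1 ->
  wirtinger f z (derive1 f z) 0.
Proof.
(* [nbhs0] is not punctured, so the quotient must take the value of the derivative at h = 0 to
   converge. *)
move=> df; pose q (h : K) := if h == 0 then derive1 f z else h^-1 *: (f (z + h) - f z).
exists q, (fun=> 0); split; [|exact: cvg_cst|]; last first.
  move=> h; rewrite /q; case: eqVneq => [->|h0].
    by rewrite conjC0 !scale0r !addr0.
  by rewrite scalerA divff// scale1r scaler0 addr0 [RHS]addrC subrK.
suff : {for (0 : K^o), continuous (q : K^o -> V)}.
  by rewrite /prop_for /continuous_at {2}/q eqxx.
apply/(@continuous_withinNshiftx _ K^o).
rewrite {2}/q eqxx derive1E; apply: cvg_trans df.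
apply: near_eq_cvg; near=> h.
have h0 : h != 0 by near: h; exact: nbhs_dnbhs_neq.
rewrite /q /= addr0 (negbTE h0) [h *: 1]mulr1.
by rewrite [h + z]addrC.
Unshelve. all: by end_near. Qed.

Lemma wirtinger_shift V (u : K -> V) z l A B :
  wirtinger u (z + l) A B -> wirtinger (fun z => u (z + l)) z A B.
Proof.
by case=> a [b [ca cb uE]]; exists a, b; split => // h; rewrite addrAC uE.
Qed.

(** Norm preservation makes [T] continuous, so the unitary of a lattice translation passes through
    both derivatives. *)
Lemma wirtinger_isometry V (T : V -> V) (u : K -> V) z A B :
  (forall a u v, T (a *: u + v) = a *: T u + T v) -> (forall v, `|T v| = `|v|) ->
  wirtinger u z A B -> wirtinger (fun z => T (u z)) z (T A) (T B).
Proof.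
move=> Tl Tn [a [b [ca cb uE]]].
have TD u1 u2 : T (u1 + u2) = T u1 + T u2 by rewrite -[u1]scale1r Tl !scale1r.
have TB u1 u2 : T (u1 - u2) = T u1 - T u2.
  by rewrite addrC -scaleN1r Tl scaleN1r addrC.
have cT (F : K -> V) x : F h @[h --> nbhs0] --> x -> T (F h) @[h --> nbhs0] --> T x.
  move=> /cvgrPdist_le cF; apply/cvgrPdist_le => e e0.
  by apply: filterS (cF _ e0) => h; rewrite -TB Tn.
exists (T \o a), (T \o b); split; [exact: cT|exact: cT|] => h.
have TZ k w : T (k *: w) = k *: T w.
  have T0 : T 0 = 0 by apply/normr0_eq0; rewrite Tn normr0.
  by rewrite -[k *: w]addr0 Tl T0 addr0.
by rewrite uE !TD !TZ.
Qed.

Section Ip.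
Context {V : normedModType K} (ip : V -> V -> K).
Hypothesis ipl : forall a u v w, ip (a *: u + v) w = a^* * ip u w + ip v w.
Hypothesis ipC : forall u v, ip u v = (ip v u)^*.
Hypothesis ipn : forall v, ip v v = `|v| ^+ 2.

(** Antilinearity in the first slot exchanges the two derivatives of [u]: its conj z derivative [B]
    enters the z derivative of the product, and [A] the conj z derivative. *)
Lemma wirtinger_ip (u v : K -> V) z A B A' B' :
  wirtinger u z A B -> wirtinger v z A' B' ->
  wirtinger (V := K^o) (fun z => ip (u z) (v z)) z
    (ip B (v z) + ip (u z) A') (ip A (v z) + ip (u z) B').
Proof.
move=> [a [b [ca cb uE]]] wv; have cv := wirtinger_cvg0 wv.
case: wv => a' [b' [ca' cb' vE]].
exists (fun h => ip (b h) (v (z + h)) + ip (u z) (a' h)),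
  (fun h => ip (a h) (v (z + h)) + ip (u z) (b' h)); split.
- by apply: cvgD; apply: (cvg_ip ipl ipC ipn) => //; exact: cvg_cst.
- by apply: cvgD; apply: (cvg_ip ipl ipC ipn) => //; exact: cvg_cst.
move=> h; rewrite uE !(ipDl ipl) !(ipZl ipl) conjCK {1}vE.
rewrite !(ipDr ipl ipC) !(ipZr ipl ipC) /GRing.scale /=; ring.
Qed.

(* |u| is the square root of <u|u>, whose increment is
   (|u (z + h)| - |u z|) (|u (z + h)| + |u z|). *)
Lemma wirtinger_norm (u : K -> V) z A B : (forall z, u z != 0) ->
  wirtinger u z A B ->
  exists r1 r2 : K, wirtinger (V := K^o) (fun z => `|u z|) z r1 r2.
Proof.
move=> u0 wu.
have cu : `|u (z + h)| @[h --> nbhs0] --> (`|u z| : K).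
  by apply: cvg_norm; exact: wirtinger_cvg0 wu.
have [a [b [ca cb sE]]] := wirtinger_ip wu wu.
have r0 w : 0 < `|u w| by rewrite normr_gt0.
have rr h : `|u (z + h)| + `|u z| != 0 by rewrite gt_eqF // addr_gt0.
have cV : (`|u (z + h)| + `|u z|)^-1 @[h --> nbhs0] --> ((`|u z| + `|u z|)^-1 : K).
  apply: cvgV; first by rewrite gt_eqF // addr_gt0.
  by apply: cvgD => //; exact: cvg_cst.
do 2 eexists; exists (fun h => a h * (`|u (z + h)| + `|u z|)^-1),
  (fun h => b h * (`|u (z + h)| + `|u z|)^-1); split.
- exact: cvgM ca cV.
- exact: cvgM cb cV.
move=> h; have := sE h; rewrite !ipn; have := rr h.
move: `|u (z + h)| `|u z| (a h : K) (b h : K) => x y p q xy.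
have scE (k w : K) : k *: (w : K^o) = k * w by [].
rewrite !scE => E.
have -> : y + h * (p / (x + y)) + h^* * (q / (x + y)) =
    y + (x ^+ 2 - y ^+ 2) / (x + y) by rewrite E; field.
by field.
Qed.
End Ip.
End Wirtinger.

(** * Gram-Schmidt frames *)

Section GramSchmidt.
Context {R : realType} {H : normedModType R[i]} (ip : H -> H -> R[i]).
Hypothesis ipl : forall a u v w, ip (a *: u + v) w = a^* * ip u w + ip v w.
Hypothesis ipC : forall u v, ip u v = (ip v u)^*.
Hypothesis ipn : forall v, ip v v = `|v| ^+ 2.

Lemma in_span0 (vs : nat -> H) n : in_span vs n 0.
Proof. by exists (fun=> 0); rewrite big1 // => i _; rewrite scale0r. Qed.

Lemma in_spanD (vs : nat -> H) n u v :
  in_span vs n u -> in_span vs n v -> in_span vs n (u + v).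
Proof.
move=> [c ->] [d ->]; exists (fun i => c i + d i).
by rewrite -big_split; apply: eq_bigr => i _; rewrite scalerDl.
Qed.

Lemma in_spanZ (vs : nat -> H) n a u : in_span vs n u -> in_span vs n (a *: u).
Proof.
move=> [c ->]; exists (fun i => a * c i).
by rewrite scaler_sumr; apply: eq_bigr => i _; rewrite scalerA.
Qed.

Lemma in_spanN (vs : nat -> H) n u : in_span vs n u -> in_span vs n (- u).
Proof. by rewrite -scaleN1r; exact: in_spanZ. Qed.

Lemma in_span_sum (vs : nat -> H) n m (F : 'I_m -> H) :
  (forall i, in_span vs n (F i)) -> in_span vs n (\sum_(i < m) F i).
Proof.
move=> sF; elim/big_rec: _ => [|i x _]; first exact: in_span0.
exact: in_spanD.
Qed.

Lemma in_span_id (vs : nat -> H) n k : (k < n)%N -> in_span vs n (vs k).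
Proof.
move=> kn; exists (fun i : 'I_n => (i == Ordinal kn)%:R).
rewrite (bigD1 (Ordinal kn)) //= eqxx scale1r big1 ?addr0 // => i /negbTE ->.
by rewrite scale0r.
Qed.

Lemma in_span_trans (vs ws : nat -> H) n m u :
  (forall k, (k < n)%N -> in_span ws m (vs k)) -> in_span vs n u -> in_span ws m u.
Proof.
by move=> vw [c ->]; apply: in_span_sum => i; apply: in_spanZ; exact: vw.
Qed.

Lemma in_span_le (vs : nat -> H) n m u : (n <= m)%N -> in_span vs n u -> in_span vs m u.
Proof.
move=> nm; apply: in_span_trans => k kn; apply: in_span_id.
exact: leq_trans kn nm.
Qed.

Lemma ip_span0 (vs : nat -> H) n u w :
  (forall k, (k < n)%N -> ip (vs k) w = 0) -> in_span vs n u -> ip u w = 0.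
Proof.
move=> vw [c ->]; rewrite (ip_suml ipl) big1 // => i _.
by rewrite (ipZl ipl) vw ?mulr0.
Qed.

(** Two vectors meeting the conditions under [xget] differ by an element of the span that is
    orthogonal to the span, hence by 0. *)
Lemma orth_projE (vs : nat -> H) n v w : in_span vs n w ->
  (forall k, (k < n)%N -> ip (vs k) (v - w) = 0) -> orth_proj ip vs n v = w.
Proof.
move=> sw ow; apply: xget_unique => // w' [sw' ow'].
apply/eqP; rewrite -subr_eq0; apply/eqP/(ip_eq0 ipn).
apply: (@ip_span0 vs n); last by apply: in_spanD => //; exact: in_spanN.
move=> k kn; have -> : w' - w = (v - w) - (v - w').
  by rewrite opprB [RHS]addrC addrA subrK.
by rewrite (ipBr ipl ipC) ow // ow' // subr0.
Qed.

Variables (g v : nat -> H).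
Hypothesis g_free : forall n (c : 'I_n.+1 -> R[i]),
  \sum_(k < n.+1) c k *: g k = 0 -> forall k, c k = 0.
Hypothesis vE : forall n, v n = g n - orth_proj ip g n (g n).

Let coef n k := ip (v k) (g n) / ip (v k) (v k).

(** One strong induction, because the three claims feed each other: nonvanishing of the earlier
    vectors makes the coefficients meaningful, orthogonality makes the sum satisfy the conditions on
    the projection, and the triangular formula shows that the [g k] and the [v k] below n span the
    same space. *)
Lemma gram_schmidt n : [/\ v n != 0, forall k, (k < n)%N -> ip (v k) (v n) = 0 &
  v n = g n - \sum_(k < n) coef n k *: v k].
Proof.
elim/ltn_ind: n => n IH.
have vg k : (k < n)%N -> in_span g k.+1 (v k).
  elim/ltn_ind: k => k IHk kn; have [_ _ ->] := IH k kn.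
  apply: in_spanD; first exact: in_span_id.
  apply/in_spanN/in_span_sum => i; apply: in_spanZ.
  have ik := ltn_ord i.
  by apply: in_span_le (IHk i ik (ltn_trans ik kn)); exact: ltnW.
have gv k : (k < n)%N -> in_span v k.+1 (g k).
  move=> kn; have [_ _ vk] := IH k kn.
  have -> : g k = v k + \sum_(i < k) coef k i *: v i by rewrite {1}vk subrK.
  apply: in_spanD; first exact: in_span_id.
  apply: in_span_sum => i; apply: in_spanZ; apply: in_span_id.
  exact: ltn_trans (ltn_ord i) _.
have orth i j : (i < n)%N -> (j < n)%N -> i != j -> ip (v i) (v j) = 0.
  move=> iN jN; rewrite neq_ltn => /orP[ij|ji].
    by have [_ /(_ _ ij)] := IH j jN.
  by have [_ /(_ _ ji) ji0] := IH i iN; rewrite ipC ji0 rmorph0.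
pose w := \sum_(k < n) coef n k *: v k.
have ow k : (k < n)%N -> ip (v k) (g n - w) = 0.
  move=> kn; rewrite (ipBr ipl ipC) (ip_sumr ipl ipC) (bigD1 (Ordinal kn)) //=.
  rewrite big1 => [|i ik]; last first.
    by rewrite (ipZr ipl ipC) orth ?mulr0 // eq_sym.
  have [vk0 _ _] := IH k kn.
  by rewrite addr0 (ipZr ipl ipC) mulfVK ?subrr // gt_eqF ?(ip_gt0 ipn).
have sw : in_span g n w.
  apply: in_span_sum => i; apply: in_spanZ.
  by apply: in_span_le (vg i (ltn_ord i)).
have vnE : v n = g n - w.
  rewrite vE (orth_projE sw) // => k kn.
  apply: (@ip_span0 v n); first exact: ow.
  by apply: in_span_le (gv k kn).
split => //; last by move=> k kn; rewrite vnE ow.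
case: sw => c wc; apply/eqP => v0.
(* If v_n were 0, then g_n = [w] would be a dependence among g_0, ..., g_n with coefficient 1 at
   g_n. *)
have /g_free /(_ ord_max) : \sum_(k < n.+1)
    (if unlift ord_max k is Some j then - c j else 1) *: g k = 0.
  apply: etrans v0; rewrite big_ord_recr /= unlift_none scale1r vnE wc addrC.
  congr (_ + _).
  rewrite -sumrN; apply: eq_bigr => i _.
  have -> : widen_ord (leqnSn n) i = lift ord_max i.
    by apply: val_inj; rewrite [RHS]lift_max.
  by rewrite liftK scaleNr.
by rewrite unlift_none => /eqP; rewrite oner_eq0.
Qed.

Lemma gs_orth i j : i != j -> ip (v i) (v j) = 0.
Proof.
rewrite neq_ltn => /orP[ij|ji].
  by have [_ /(_ _ ij)] := gram_schmidt j.
by have [_ /(_ _ ji) ji0 _] := gram_schmidt i; rewrite ipC ji0 rmorph0.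
Qed.

Lemma gs_neq0 n : ip (v n) (v n) != 0.
Proof. by have [v0 _ _] := gram_schmidt n; rewrite gt_eqF ?(ip_gt0 ipn). Qed.

Lemma gs_span_expand n u : in_span v n u ->
  u = \sum_(k < n) (ip (v k) u / ip (v k) (v k)) *: v k.
Proof.
move=> [c ->]; apply: eq_bigr => k _; congr (_ *: _).
rewrite (ip_sumr ipl ipC) (bigD1 k) //= big1 => [|i ik].
  by rewrite addr0 (ipZr ipl ipC) mulfK ?gs_neq0.
by rewrite (ipZr ipl ipC) gs_orth ?mulr0 // eq_sym.
Qed.

Lemma gs_diff_span n : in_span v n (g n - v n).
Proof.
have [_ _ ->] := gram_schmidt n; rewrite opprB addrC subrK.
by apply: in_span_sum => i; apply: in_spanZ; exact: in_span_id.
Qed.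

(** g_n - v_n lies in the span of the earlier v_k, to which v_n is orthogonal. *)
Lemma gs_ip_leading n : ip (v n) (g n) = ip (v n) (v n).
Proof.
rewrite -[g n](subrK (v n)) (ipDr ipl ipC) [X in X + _](_ : _ = 0) ?add0r //.
rewrite ipC; apply/eqP; rewrite conjC_eq0; apply/eqP.
by apply: (ip_span0 _ (gs_diff_span n)) => k kn; rewrite gs_orth // ltn_eqF.
Qed.

End GramSchmidt.

(** * Real directional derivatives and uniqueness of Wirtinger derivatives *)

Section RealDirections.
Context {R : realType}.
Implicit Types V : normedModType R[i].

Lemma cvg_real_ray (d : R[i]) :
  ((t%:C)%C * d : R[i]) @[t --> (0 : R)^'] --> @nbhs0 R[i].
Proof.
have tC : ((t%:C)%C : R[i]^o) @[t --> (0 : R)^'] --> (0 : R[i]^o).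
  apply/(@cvgrPdist_le R[i] (R[i]^o)) => e e0.
  have e1 : e = ((complex.Re e)%:C)%C.
    by rewrite RRe_real // realE ltW.
  have e2 : 0 < complex.Re e by move: e0; rewrite e1 ltcR.
  near=> t; rewrite sub0r normrN e1 normc_def /= expr0n addr0 sqrtr_sqr lecR.
  by near: t; apply: dnbhs0_le.
have : ((t%:C)%C * d : R[i]^o) @[t --> (0 : R)^'] --> (0 * d : R[i]^o).
  exact: (@cvgZ _ (R[i]^o) _ _ _ _ _ _ _ tC (cvg_cst _)).
by rewrite mul0r.
Unshelve. all: by end_near. Qed.

Lemma wirtinger_real_ray V (u : R[i] -> V) z A B (d : R[i]) :
  wirtinger u z A B ->
  ((t%:C)%C^-1 *: (u (z + (t%:C)%C * d) - u z)) @[t --> (0 : R)^'] --> d *: A + d^* *: B.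
Proof.
case=> a [b [ca cb uE]].
have lim : (d *: a ((t%:C)%C * d) + d^* *: b ((t%:C)%C * d)) @[t --> (0 : R)^']
    --> d *: A + d^* *: B.
  apply: cvgD; apply: cvgZ; try exact: cvg_cst.
    exact: cvg_comp (cvg_real_ray d) ca.
  exact: cvg_comp (cvg_real_ray d) cb.
apply: cvg_trans lim; apply: near_eq_cvg; near=> t.
have t0 : t != 0 by near: t; exact: nbhs_dnbhs_neq.
have t0' : (t%:C)%C != 0 :> R[i] by rewrite eq_complex /= eqxx andbT.
rewrite uE -(addrA (u z)) [u z + (_ + _)]addrC addrK scalerDr !scalerA mulKf //; congr (_ + _ *: _).
have tR : ((t%:C)%C : R[i])^* = (t%:C)%C.
  by apply/eqP; rewrite eq_complex /= oppr0 !eqxx.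
by rewrite rmorphM /= tR mulKf.
Unshelve. all: by end_near. Qed.

Lemma wirtinger_pd V (u : R[i] -> V) z A B (d : R[i]) :
  wirtinger u z A B -> pd d u z = d *: A + d^* *: B.
Proof. by move=> /wirtinger_real_ray wu; apply: cvg_lim. Qed.

(** The directions 1 and i give A + B and i (A - B), which determine A and B. Identities between
    derivatives are obtained from this by differentiating one function in two ways. *)
Lemma wirtinger_unique V (u : R[i] -> V) z A B A' B' :
  wirtinger u z A B -> wirtinger u z A' B' -> A = A' /\ B = B'.
Proof.
move=> w w'.
have E d : d *: A + d^* *: B = d *: A' + d^* *: B'.
  by rewrite -(wirtinger_pd d w) (wirtinger_pd d w').
have E1 : A - A' = B' - B.
  have := E 1; rewrite rmorph1 !scale1r => AB.
  by apply/eqP; rewrite subr_eq addrAC eq_sym subr_eq AB addrC.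
have E2 : A - A' = B - B'.
  have := E 'i; rewrite conjCi !scaleNr -!scalerBr => /(scalerI (neq0Ci _)) AB.
  apply/eqP; rewrite subr_eq -{1}(subrK B A) AB.
  by rewrite -[eqbRHS]addrA [- B' + A']addrC addrC.
have : (A - A') *+ 2 = 0 by rewrite mulr2n {1}E1 E2 -opprB addNr.
rewrite -scaler_nat => /eqP; rewrite scaler_eq0 pnatr_eq0 /= subr_eq0 => /eqP AA.
by split=> //; move/eqP: E2; rewrite AA subrr eq_sym subr_eq0 => /eqP.
Qed.

End RealDirections.

(** * Derivatives of the Gram-Schmidt frame *)

Section MovingFrame.
Context {R : realType} {H : normedModType R[i]} (ip : H -> H -> R[i]).
Hypothesis ipl : forall a u v w, ip (a *: u + v) w = a^* * ip u w + ip v w.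
Hypothesis ipC : forall u v, ip u v = (ip v u)^*.
Hypothesis ipn : forall v, ip v v = `|v| ^+ 2.
Variables (g v : nat -> R[i] -> H).

Definition sqnorm n z : R[i] := ip (v n z) (v n z).
Definition norm_ratio n z : R[i] := sqnorm n.+1 z / sqnorm n z.
(** The convention a_{-1} = 0 also neutralises [v n.-1] at n = 0, where the truncated predecessor
    returns v_0 itself. *)
Definition prev_ratio n z : R[i] := if n is m.+1 then norm_ratio m z else 0.
Definition subdiag n z : R[i] := ip (v n z) (g n.+1 z) / sqnorm n z.
(** The coefficient b_n of v_n in d v_n. The subtracted l_{n-1} is the Gram-Schmidt coefficient of
    v_{n-1} in g_n; it appears because d v_{n-1} contains v_n. *)
Definition connection n z : R[i] :=
  subdiag n z - (if n is m.+1 then subdiag m z else 0).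

Hypothesis g_free : forall z n (c : 'I_n.+1 -> R[i]),
  \sum_(k < n.+1) c k *: g k z = 0 -> forall k, c k = 0.
Hypothesis vE : forall n z, v n z = g n z - orth_proj ip (g^~ z) n (g n z).
Hypothesis dg : forall n z, wirtinger (g n) z (g n.+1 z) 0.

Let gs z n := @gram_schmidt _ _ _ ipl ipC ipn (g^~ z) (v^~ z) (@g_free z) (vE^~ z) n.

Lemma frame_orth z i j : i != j -> ip (v i z) (v j z) = 0.
Proof.
exact: (@gs_orth _ _ _ ipl ipC ipn (g^~ z) (v^~ z) (@g_free z) (vE^~ z)).
Qed.
Let orth := frame_orth.

Lemma sqnorm_neq0 n z : sqnorm n z != 0.
Proof.
exact: (@gs_neq0 _ _ _ ipl ipC ipn (g^~ z) (v^~ z) (@g_free z) (vE^~ z)).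
Qed.
Let sq0 := sqnorm_neq0.

Let expand z n u :=
  @gs_span_expand _ _ _ ipl ipC ipn (g^~ z) (v^~ z) (@g_free z) (vE^~ z) n u.

Lemma sqnorm_real n z : (sqnorm n z)^* = sqnorm n z.
Proof. by rewrite /sqnorm -ipC. Qed.

Let coef n k z := ip (v k z) (g n z) / sqnorm k z.

Let wirtinger_ipE := wirtinger_ip ipl ipC ipn.

(* The orthogonality relations [<v_k, v_n> = 0], k < n, differentiated with
   respect to z and conj z, kill all the other coordinates of the derivatives. *)
Lemma wirtinger_frame n z : wirtinger (v n) z
  (v n.+1 z + connection n z *: v n z) (- prev_ratio n z *: v n.-1 z).
Proof.
elim/ltn_ind: n z => n IH z.
have dsq k : (k < n)%N -> exists A B, wirtinger (V := (R[i])^o) (sqnorm k) z A B.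
  by move=> kn; do 2 eexists; apply: wirtinger_ipE; exact: IH.
have dcoef k : (k < n)%N -> exists c : R[i] * R[i],
    wirtinger (V := (R[i])^o) (coef n k) z c.1 c.2.
  move=> kn; have [A [B dk]] := dsq k kn; have wI := wirtinger_ipE (IH k kn z) (dg n z).
  by eexists (_, _); exact: (wirtingerM wI (wirtingerV (sq0 k) dk)).
have [cd cdP] : exists cd : 'I_n -> R[i] * R[i], forall k : 'I_n,
    wirtinger (V := (R[i])^o) (coef n k) z (cd k).1 (cd k).2.
  by have /choice[cd] := fun k : 'I_n => dcoef k (ltn_ord k); exists cd.
(* Derivatives of the Gram-Schmidt formula term by term. The derivatives [cd] of the coefficients
   stay unknown; only the spans containing A - v_{n+1} and B are read off. *)
pose A := g n.+1 z - \sum_(k < n) ((cd k).1 *: v k z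
  + coef n k z *: (v k.+1 z + connection k z *: v k z)).
pose B := 0 - \sum_(k < n) ((cd k).2 *: v k z
  + coef n k z *: (- prev_ratio k z *: v k.-1 z)).
have wv : wirtinger (v n) z A B.
  rewrite [X in wirtinger X](_ : _ = fun x => g n x - \sum_(k < n) coef n k x *: v k x).
    apply: wirtingerB => //; apply: wirtinger_sum => k.
    by apply: wirtingerZ => //; exact: IH.
  by apply/funext => x; have [_ _ ->] := gs x n.
have sB : in_span (v^~ z) n B.
  rewrite /B sub0r; apply/in_spanN/in_span_sum => k; apply: in_spanD; apply: in_spanZ.
    exact: (@in_span_id _ _ (v^~ z)).
  apply: in_spanZ; apply: (@in_span_id _ _ (v^~ z)).
  exact: leq_ltn_trans (leq_pred _) (ltn_ord k).
have sA : in_span (v^~ z) n.+1 (A - v n.+1 z).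
  rewrite /A addrAC; apply: in_spanD.
    exact: (@gs_diff_span _ _ _ ipl ipC ipn (g^~ z) (v^~ z) (@g_free z) (vE^~ z)).
  apply/in_spanN/in_span_sum => k.
  have kn : (k < n.+1)%N := ltnW (ltn_ord k).
  apply: in_spanD; apply: in_spanZ; first exact: (@in_span_id _ _ (v^~ z)).
  apply: in_spanD; last apply: in_spanZ.
    exact: (@in_span_id _ _ (v^~ z) n.+1 k.+1 (ltn_ord k)).
  exact: (@in_span_id _ _ (v^~ z)).
have dorth k : (k < n)%N ->
    ip (- prev_ratio k z *: v k.-1 z) (v n z) + ip (v k z) A = 0 /\
    ip (v k.+1 z + connection k z *: v k z) (v n z) + ip (v k z) B = 0.
  move=> kn; have := wirtinger_ipE (IH k kn z) wv.
  rewrite [X in wirtinger X](_ : _ = fun=> 0); last first.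
    by apply/funext => x; rewrite orth // ltn_eqF.
  by move=> /wirtinger_unique /(_ (wirtinger_cst (0 : (R[i])^o) z)).
have ipA k : (k < n)%N -> ip (v k z) A = 0.
  move=> kn; have [<- _] := dorth k kn.
  rewrite (ipZl ipl) orth ?mulr0 ?add0r // ltn_eqF //.
  exact: leq_ltn_trans (leq_pred _) kn.
have ipB k : (k < n)%N -> ip (v k z) B = - ip (v k.+1 z) (v n z).
  move=> kn; have [_ /eqP] := dorth k kn.
  rewrite (ipDl ipl) (ipZl ipl) (orth _ (_ : k != n)) ?mulr0 ?addr0 ?ltn_eqF //.
  by rewrite addrC addr_eq0 => /eqP.
(* Among the terms of the sum only k = n - 1 has a component along v_n, through [v k.+1], with
   coefficient l_{n-1}. *)
have ipAn : ip (v n z) A = connection n z * sqnorm n z.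
  rewrite /A (ipBr ipl ipC) (ip_sumr ipl ipC) /connection mulrBl mulfVK //.
  congr (_ - _).
  transitivity (\sum_(k < n) coef n k z * ip (v n z) (v k.+1 z)).
    apply: eq_bigr => k _; rewrite !(ipDr ipl ipC) !(ipZr ipl ipC) !(ipDr ipl ipC).
    by rewrite !(ipZr ipl ipC) (orth _ (_ : n != k)) ?gtn_eqF // !mulr0 add0r addr0.
  case: (n) => [|m]; first by rewrite big_ord0 mul0r.
  rewrite big_ord_recr /= big1 ?add0r // => i _.
  by rewrite orth ?mulr0 // gtn_eqF // ltnS.
have -> : v n.+1 z + connection n z *: v n z = A.
  rewrite -[A](subrK (v n.+1 z)) addrC; congr (_ + _).
  rewrite (expand sA) big_ord_recr /=.
  rewrite big1 => [|i _]; last first.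
    rewrite (ipBr ipl ipC) ipA // orth ?subr0 ?mul0r ?scale0r //.
    by rewrite ltn_eqF // ltnW // ltnS ltn_ord.
  rewrite add0r (ipBr ipl ipC) ipAn orth ?ltn_eqF // subr0 mulfK //.
have -> : - prev_ratio n z *: v n.-1 z = B.
  rewrite (expand sB).
  transitivity (\sum_(k < n) (- ip (v k.+1 z) (v n z) / sqnorm k z) *: v k z).
    case: (n) => [|m]; first by rewrite big_ord0 oppr0 scale0r.
    rewrite big_ord_recr /= big1 ?add0r ?mulNr // => i _.
    by rewrite orth ?oppr0 ?mul0r ?scale0r // ltn_eqF // ltnS.
  by apply: eq_bigr => k _; rewrite ipB.
exact: wv.
Qed.

(** Since [g n.+1] is holomorphic, dbar of the numerator is <d v_n|g_{n+1}> = |v_{n+1}|^2 + conj b_n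
    <v_n|g_{n+1}>, and the last term is cancelled by dbar |v_n|^2 = conj b_n |v_n|^2 in the
    denominator. The z derivative is explicit so that its continuity can be read off. *)
Lemma wirtinger_subdiag n z : wirtinger (V := (R[i])^o) (subdiag n) z
  ((ip (- prev_ratio n z *: v n.-1 z) (g n.+1 z) + ip (v n z) (g n.+2 z)) / sqnorm n z
    - connection n z * subdiag n z)
  (norm_ratio n z).
Proof.
have wv := wirtinger_frame n z.
have wS := wirtinger_ipE wv wv; have wN := wirtinger_ipE wv (dg n.+1 z).
have := wirtingerM wN (wirtingerV (sq0 n) wS).
have vB : ip (v n z) (- prev_ratio n z *: v n.-1 z) = 0.
  rewrite (ipZr ipl ipC); case: n {wv wS wN} => [|n]; first by rewrite oppr0 mul0r.
  by rewrite orth ?mulr0 // gtn_eqF.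
have Bv : ip (- prev_ratio n z *: v n.-1 z) (v n z) = 0 by rewrite ipC vB rmorph0.
have lead : ip (v n.+1 z) (g n.+1 z) = sqnorm n.+1 z.
  exact: (@gs_ip_leading _ _ _ ipl ipC ipn (g^~ z) (v^~ z) (@g_free z) (vE^~ z)).
have A1 w : ip (v n.+1 z + connection n z *: v n z) w
    = ip (v n.+1 z) w + (connection n z)^* * ip (v n z) w.
  by rewrite (ipDl ipl) (ipZl ipl).
have A2 : ip (v n z) (v n.+1 z + connection n z *: v n z)
    = connection n z * sqnorm n z.
  by rewrite (ipDr ipl ipC) (ipZr ipl ipC) orth ?ltn_eqF // add0r.
have A3 : ip (v n.+1 z) (v n z) = 0 by rewrite orth // gtn_eqF.
rewrite !A1 A2 A3 vB Bv lead (ip0r ipl ipC) !addr0 !add0r.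
rewrite [in X in _ -> X]/subdiag [in X in _ -> X]/norm_ratio.
rewrite -[ip (v n z) (v n z)]/(sqnorm n z).
have := sq0 n z.
move: (sqnorm n z) (connection n z) => S b S0.
move: (ip (v n z) (g n.+1 z)) (sqnorm n.+1 z) (ip _ _ + ip _ _ : R[i]) => N S1 M.
have -> : M / S - b * (N / S) = M / S + N * (- (b * S) / S ^+ 2) by field.
by have -> : S1 / S = (S1 + b^* * N) / S + N * (- (b^* * S) / S ^+ 2) by field.
Qed.

End MovingFrame.

(** * Behaviour of the frame under lattice translations *)

Section Periodicity.
Context {R : realType} {H : normedModType R[i]} (ip : H -> H -> R[i]).
Hypothesis ipl : forall a u v w, ip (a *: u + v) w = a^* * ip u w + ip v w.
Hypothesis ipC : forall u v, ip u v = (ip v u)^*.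
Hypothesis ipn : forall v, ip v v = `|v| ^+ 2.
Variables (g v : nat -> R[i] -> H).
Hypothesis g_free : forall z n (c : 'I_n.+1 -> R[i]),
  \sum_(k < n.+1) c k *: g k z = 0 -> forall k, c k = 0.
Hypothesis vE : forall n z, v n z = g n z - orth_proj ip (g^~ z) n (g n z).
Hypothesis dg : forall n z, wirtinger (g n) z (g n.+1 z) 0.

Let wv := wirtinger_frame ipl ipC ipn g_free vE dg.
Let orth := frame_orth ipl ipC ipn g_free vE.
Let S0 := sqnorm_neq0 ipl ipC ipn g_free vE.
Let conn := connection ip g v.

Section Translation.
Variables (l : R[i]) (c c' : R[i] -> R[i]) (T : H -> H).
Hypothesis c0 : forall z, c z != 0.
Hypothesis dc : forall z, wirtinger (V := (R[i])^o) c z (c' z) 0.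
Hypothesis TL : forall a u v, T (a *: u + v) = a *: T u + T v.
Hypothesis Tip : forall u v, ip (T u) (T v) = ip u v.
Hypothesis gT : forall z, g 0 (z + l) = c z *: T (g 0 z).

(** Differentiating v_n (z + l) = c T v_n in two ways gives v_{n+1} (z + l) + b_n (z + l) v_n (z +
    l) = c' T v_n + c T (v_{n+1} + b_n v_n). The component along T v_n is the law for b_n, and the
    rest is the law for v_{n+1}. No expansion of higher derivatives of c T f is involved. *)
Lemma translation_step n : (forall z, v n (z + l) = c z *: T (v n z)) ->
  forall z, conn n (z + l) = conn n z + c' z / c z /\
    v n.+1 (z + l) = c z *: T (v n.+1 z).
Proof.
move=> vT z.
have Tn w : `|T w| = `|w|.
  have := Tip w w; rewrite !ipn => /eqP.
  by rewrite eqrXn2 // => /eqP.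
have w1 := wirtinger_shift (wv n (z + l)).
rewrite (_ : (fun z => v n (z + l)) = fun z => c z *: T (v n z)) in w1; last first.
  by apply/funext => x; rewrite vT.
have [AA _] := wirtinger_unique w1 (wirtingerZ (dc z) (wirtinger_isometry TL Tn (wv n z))).
have TD u1 u2 : T (u1 + u2) = T u1 + T u2 by rewrite -[u1]scale1r TL !scale1r.
have TZ k w : T (k *: w) = k *: T w.
  have T0 : T 0 = 0 by apply/normr0_eq0; rewrite Tn normr0.
  by rewrite -[k *: w]addr0 TL T0 addr0.
rewrite -/conn vT TD TZ in AA.
have o1 : ip (T (v n z)) (v n.+1 (z + l)) = 0.
  have : ip (v n (z + l)) (v n.+1 (z + l)) = 0 by rewrite orth // ltn_eqF.
  rewrite vT (ipZl ipl) => /eqP; rewrite mulf_eq0 conjC_eq0 (negbTE (c0 z)) /=.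
  by move/eqP.
have o2 : ip (T (v n z)) (T (v n.+1 z)) = 0 by rewrite Tip orth // ltn_eqF.
have connE : conn n (z + l) = conn n z + c' z / c z.
  have := congr1 (ip (T (v n z))) AA.
  rewrite !(ipDr ipl ipC) !(ipZr ipl ipC) !(ipDr ipl ipC) !(ipZr ipl ipC) o1 o2.
  rewrite Tip -[ip (v n z) _]/(sqnorm ip v n z).
  move: (conn n _) (conn n _) (S0 n z) (c0 z) => y x.
  move: (sqnorm _ _ _ _) (c z) (c' z) => s k k' s0 k0 E.
  apply: (mulIf s0); apply: (mulIf k0).
  have -> : x * s * k = 0 + x * (k * s) by ring.
  by rewrite E; field.
split=> //; apply: (addIr (conn n (z + l) *: (c z *: T (v n z)))).
rewrite AA connE scalerDr addrCA !scalerA -scalerDl; congr (_ + _ *: _).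
by field.
Qed.

Lemma frame_translation n z : v n (z + l) = c z *: T (v n z).
Proof.
elim: n z => [|n IH] z; last by have [] := translation_step IH z.
have [_ _] := @gram_schmidt _ _ _ ipl ipC ipn (g^~ z) (v^~ z) (@g_free z) (vE^~ z) 0.
have [_ _] := @gram_schmidt _ _ _ ipl ipC ipn (g^~ (z + l)) (v^~ (z + l))
  (@g_free (z + l)) (vE^~ (z + l)) 0.
by rewrite !big_ord0 !subr0 => -> ->.
Qed.

Lemma norm_ratio_translation n z :
  norm_ratio ip v n (z + l) = norm_ratio ip v n z.
Proof.
have SE m : sqnorm ip v m (z + l) = (c z)^* * c z * sqnorm ip v m z.
  by rewrite /sqnorm frame_translation (ipZl ipl) (ipZr ipl ipC) Tip mulrA.
by rewrite /norm_ratio !SE -mulf_div divff ?mul1r // mulf_neq0 ?conjC_eq0.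
Qed.

(** l_n is the sum of b_0, ..., b_n, and each of them changes by c'/c. *)
Lemma subdiag_translation n z :
  subdiag ip g v n (z + l) = subdiag ip g v n z + n.+1%:R * (c' z / c z).
Proof.
have connE m := (translation_step (frame_translation m) z).1.
elim: n => [|n IH].
  by have := connE 0; rewrite /conn /connection !subr0 mul1r.
have := connE n.+1; rewrite /conn /connection IH => /eqP.
by rewrite subr_eq => /eqP ->; rewrite -[in RHS]natr1; ring.
Qed.
End Translation.
End Periodicity.

(** * The quantum geometric tensor of the normalised frame *)

Section QuantumGeometry.
Context {R : realType} {H : normedModType R[i]} (ip : H -> H -> R[i]).
Hypothesis ipl : forall a u v w, ip (a *: u + v) w = a^* * ip u w + ip v w.
Hypothesis ipC : forall u v, ip u v = (ip v u)^*.
Hypothesis ipn : forall v, ip v v = `|v| ^+ 2.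

Variables (g v : nat -> R[i] -> H).
Hypothesis g_free : forall z n (c : 'I_n.+1 -> R[i]),
  \sum_(k < n.+1) c k *: g k z = 0 -> forall k, c k = 0.
Hypothesis vE : forall n z, v n z = g n z - orth_proj ip (g^~ z) n (g n z).
Hypothesis dg : forall n z, wirtinger (g n) z (g n.+1 z) 0.

Let wv := wirtinger_frame ipl ipC ipn g_free vE dg.
Let orth := frame_orth ipl ipC ipn g_free vE.
Let S0 := sqnorm_neq0 ipl ipC ipn g_free vE.

(** Normalisation changes the derivatives of v_n / |v_n| only by multiples of v_n, which 1 - |u><u|
    removes; hence [r1] and [r2] stay unspecified. What remains in direction d is d v_{n+1} - conj d
    a_{n-1} v_{n-1}, divided by |v_n|. The two components are orthogonal, and a_{n-1}^2 |v_{n-1}|^2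
    / |v_n|^2 = a_{n-1}. *)
Lemma qgt_frame n da db z :
  qgt ip (fun z => `|v n z|^-1 *: v n z) da db z =
  da^* * db * norm_ratio ip v n z + da * db^* * prev_ratio ip v n z.
Proof.
have v0 w : v n w != 0.
  by have [] := @gram_schmidt _ _ _ ipl ipC ipn (g^~ w) (v^~ w) (@g_free w) (vE^~ w) n.
have [r1 [r2 wr]] := wirtinger_norm ipl ipC ipn v0 (wv n z).
have rv0 w : `|v n w| != 0 by rewrite normr_eq0.
have := wirtingerZ (wirtingerV rv0 wr) (wv n z).
set k1 := - r1 / _; set k2 := - r2 / _ => wu; set r := `|v n z|.
have r0 : r != 0 by rewrite normr_eq0.
have rr : r^* = r by rewrite conj_Creal // normr_real.
have SE : sqnorm ip v n z = r ^+ 2 by rewrite /sqnorm ipn.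
pose w (d : R[i]) := r^-1 *: (d *: v n.+1 z - (d^* * prev_ratio ip v n z) *: v n.-1 z).
have pdE d : exists s, pd d (fun z => `|v n z|^-1 *: v n z) z = s *: v n z + w d.
  rewrite (wirtinger_pd d wu).
  exists (d * k1 + d * (r^-1 * connection ip g v n z) + d^* * k2).
  rewrite -[w d]/(r^-1 *: (d *: _ - _ *: _)) -/r.
  move: (connection ip g v n z) => b; rewrite scaleNr !scalerDr !scalerDl !scalerN !scalerA.
  rewrite [LHS](AC ((1*2)*2) ((1*3*4)*(2*5))) !mulrA.
  by rewrite ![_ / r]mulrC.
have wvo d : ip (v n z) (w d) = 0.
  rewrite (ipZr ipl ipC) (ipBr ipl ipC) !(ipZr ipl ipC) orth ?ltn_eqF //.
  rewrite mulr0 sub0r; case: (n) => [|m]; first by rewrite mulr0 mul0r oppr0 mulr0.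
  by rewrite orth ?mulr0 ?oppr0 ?mulr0 // gtn_eqF.
have [sa Ea] := pdE da; have [sb Eb] := pdE db.
rewrite /qgt Ea Eb.
have -> : ip (r^-1 *: v n z) (sb *: v n z + w db) *: (r^-1 *: v n z) = sb *: v n z.
  rewrite (ipZl ipl) (ipDr ipl ipC) wvo (ipZr ipl ipC) addr0 scalerA.
  rewrite -[ip (v n z) _]/(sqnorm ip v n z) SE fmorphV /= rr.
  by congr (_ *: _); field.
rewrite [sb *: v n z + w db]addrC addrK (ipDl ipl) (ipZl ipl) wvo mulr0 add0r.
have prevE : prev_ratio ip v n z ^+ 2 * sqnorm ip v n.-1 z
    = prev_ratio ip v n z * r ^+ 2.
  rewrite -SE; case: (n) => [|m]; first by rewrite expr0n !mul0r.
  by rewrite expr2 -mulrA [norm_ratio _ _ _ _ * sqnorm _ _ m _]mulfVK.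
have prevR : (prev_ratio ip v n z)^* = prev_ratio ip v n z.
  by case: (n) => [|m]; rewrite ?conjC0 // /= /norm_ratio rmorphM fmorphV /= !sqnorm_real.
have o1 : ip (v n.+1 z) (v n.-1 z) = 0.
  by rewrite orth // gtn_eqF // ltnS leq_pred.
have o2 : ip (v n.-1 z) (v n.+1 z) = 0 by rewrite ipC o1 rmorph0.
rewrite /w (ipZl ipl) (ipZr ipl ipC) !(ipBl ipl) !(ipBr ipl ipC) !(ipZl ipl).
rewrite !(ipZr ipl ipC) o1 o2 -[ip (v n.+1 z) _]/(sqnorm ip v n.+1 z).
rewrite -[ip (v n.-1 z) _]/(sqnorm ip v n.-1 z) !rmorphM /= conjCK prevR fmorphV /= rr.
rewrite /norm_ratio SE.
have -> : da * db^* * prev_ratio ip v n z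
    = da * db^* * (prev_ratio ip v n z ^+ 2 * sqnorm ip v n.-1 z) / r ^+ 2.
  by rewrite prevE; field.
by field.
Qed.
End QuantumGeometry.

(** * Smoothness of the iterated derivatives *)

Section RealDerivative.
Context {R : realType}.

Lemma ReB (x y : R[i]) : complex.Re (x - y) = complex.Re x - complex.Re y.
Proof. by case: x; case: y. Qed.

Lemma ReZ (k : R) (x : R[i]) : complex.Re ((k%:C)%C * x) = k * complex.Re x.
Proof. by case: x => a b /=; rewrite mul0r subr0. Qed.

(** Real parts along a line are real functions of one real variable, to which the mean value theorem
    applies. *)
Lemma wirtinger_is_derive (u : R[i] -> R[i]) (z d A B : R[i]) (t : R) :
  wirtinger (V := (R[i])^o) u (z + (t%:C)%C * d) A B ->
  is_derive t 1 (fun t => complex.Re (u (z + (t%:C)%C * d)))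
    (complex.Re (d * A + d^* * B)).
Proof.
move=> /(@wirtinger_real_ray _ _ _ _ _ _ d).
set w := z + _ => wu.
suff lim : (fun h => h^-1 *: (((fun t => complex.Re (u (z + (t%:C)%C * d))) \o shift t)
    (h *: 1) - complex.Re (u (z + (t%:C)%C * d)))) @ 0^' -->
    complex.Re (d * A + d^* * B).
  by apply: DeriveDef; [exact: cvgP lim|exact: cvg_lim lim].
apply/cvgrPdist_le => e e0.
have e0' : 0 < (e%:C)%C :> R[i] by rewrite ltcR.
have /cvgrPdist_le /(_ _ e0') := wu.
apply: filterS => h; rewrite /= -/w.
have -> : u (z + ((h *: 1 + t)%:C)%C * d) = u (w + (h%:C)%C * d).
  by rewrite [h *: 1]mulr1 rmorphD /= mulrDl /w addrAC addrA.
have -> : complex.Re (d * A + d^* * B) - h^-1 *: (complex.Re (u (w + (h%:C)%C * d))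
    - complex.Re (u w)) = complex.Re (d *: (A : (R[i])^o) + d^* *: (B : (R[i])^o)
    - (h%:C)%C^-1 *: (u (w + (h%:C)%C * d) - u w : (R[i])^o)).
  have scE (k x : R[i]) : k *: (x : (R[i])^o) = k * x by [].
  by rewrite !scE ReB -fmorphV ReZ ReB.
by move=> le1; rewrite -lecR (le_trans (normc_ge_Re _)).
Qed.

(* The mean value theorem, applied to phi between 0 and s, gives a point in
   (0, s) where psi equals the difference quotient of phi; psi varies by at most
   M from there to 1, and the quotient tends to psi 0. *)
Lemma derivative_variation (phi psi : R -> R) (M : R) :
  (forall t : R, is_derive t (1 : R) phi (psi t)) ->
  (forall t : R, 0 < t <= 1 -> exists2 d : R, is_derive t (1 : R) psi d & `|d| <= M) ->
  `|psi 1 - psi 0| <= M.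
Proof.
move=> dphi dpsi.
have M0 : 0 <= M.
  by have [|d _] := dpsi 1; [rewrite ltr01 lexx|apply: le_trans].
have step s : 0 < s < 1 -> `|psi 1 - s^-1 * (phi s - phi 0)| <= M.
  move=> /andP[s0 s1].
  have cphi : {within `[0, s], continuous phi}.
    apply: derivable_within_continuous => x _; exact: ex_derive.
  have [c /[!in_itv]/= /andP[c0 cs] ->] := MVT s0 (fun x _ => dphi x) cphi.
  rewrite subr0 mulrC mulfK ?gt_eqF //.
  have c1 : c < 1 := lt_trans cs s1.
  have dpsi' x : x \in `]c, 1[%R -> is_derive x (1 : R) psi (derive1 psi x).
    rewrite in_itv /= => /andP[cx x1].
    have [|d dx _] := dpsi x; first by rewrite (lt_trans c0 cx) ltW.
    by rewrite derive1E; apply: DeriveDef => //; exact: ex_derive.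
  have cpsi : {within `[c, 1], continuous psi}.
    apply: derivable_within_continuous => x; rewrite in_itv /= => /andP[cx x1].
    by have [|d dx _] := dpsi x; [rewrite (lt_le_trans c0 cx)|exact: ex_derive].
  have [e /[!in_itv]/= /andP[ce e1] ->] := MVT c1 dpsi' cpsi.
  have [|d dx dM] := dpsi e; first by rewrite (lt_trans c0 ce) ltW.
  have c2 : `|1 - c| <= 1.
    by rewrite ger0_norm; [rewrite gerBl ltW|rewrite subr_ge0 ltW].
  by rewrite derive1E derive_val normrM -[leRHS]mulr1 ler_pM.
rewrite leNgt; apply/negP => gtM.
have e0 : 0 < `|psi 1 - psi 0| - M by rewrite subr_gt0.
have : (fun h => h^-1 *: ((phi \o shift 0) (h *: 1) - phi 0)) @ 0^' --> psi 0.
  have := dphi 0 => -[der val].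
  by rewrite -val.
move=> /cvgrPdist_lt /(_ _ e0); rewrite near_withinE => /nbhs_ballP[r /= r0 hr].
pose s := Num.min (r / 2) (1 / 2).
have s0 : 0 < s by rewrite lt_min !divr_gt0.
have s1 : s < 1 by rewrite gt_min orbC ltr_pdivrMr // mul1r ltr1n.
have := hr s; rewrite /ball /= sub0r normrN gtr0_norm // => /(_ _ _).
have sr : s < r by rewrite gt_min ltr_pdivrMr // ltr_pMr // ltr1n.
move=> /(_ sr (lt0r_neq0 s0)); rewrite addr0 [s *: 1]mulr1 ltrBrDl => lt1.
have := step s; rewrite s0 s1 => /(_ isT) le2.
have := ler_distD (s^-1 * (phi s - phi 0)) (psi 1) (psi 0).
rewrite [in X in _ <= _ + X]distrC => le3.
by have := lt_le_trans lt1 le3; rewrite ltNge lerD2r le2.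
Qed.
End RealDerivative.

Section DifferenceQuotient.
Context {K : numClosedFieldType} {V : normedModType K}.

Lemma derivable_quotient (f : K^o -> V) (z : K^o) :
  derivable f z 1 = cvg ((fun k : K^o => k^-1 *: (f (k + z) - f z)) @ (0 : K^o)^').
Proof.
rewrite /derivable; set d1 := fun _ => _; set d2 := fun _ => _.
by have -> : d1 = d2 by apply/funext => k; rewrite /d1 /d2 /= [k *: 1]mulr1.
Qed.

Lemma derive1_quotient (f : K^o -> V) (z : K^o) :
  derive1 f z = lim ((fun k : K^o => k^-1 *: (f (k + z) - f z)) @ (0 : K^o)^').
Proof. by []. Qed.
End DifferenceQuotient.

Section Smoothness.
Context {R : realType} {H : normedModType R[i]} (ip : H -> H -> R[i]).
Hypothesis ipl : forall a u v w, ip (a *: u + v) w = a^* * ip u w + ip v w.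
Hypothesis ipC : forall u v, ip u v = (ip v u)^*.
Hypothesis ipn : forall v, ip v v = `|v| ^+ 2.

Lemma wirtinger_ipl (w : H) (u : R[i] -> H) z A :
  wirtinger u z A 0 -> wirtinger (V := (R[i])^o) (fun z => ip w (u z)) z (ip w A) 0.
Proof.
move=> wu; have := wirtinger_ip ipl ipC ipn (wirtinger_cst w z) wu.
by rewrite !(ip0l ipl) (ip0r ipl ipC) !add0r.
Qed.

(* Pairing with u = g (z + k) - g z turns the claim into one about real functions
   of the real parameter t of the segment z + t k. *)
Lemma primitive_derivative_variation (F g h : R[i] -> H) (z k : R[i]) (e : R[i]) :
  k != 0 ->
  (forall w, wirtinger F w (g w) 0) ->
  (forall w, 0 < `|w - z| <= `|k| -> wirtinger g w (h w) 0 /\ `|h w| <= e) ->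
  `|g (z + k) - g z| <= e * `|k|.
Proof.
move=> k0 dF dg.
set u := g (z + k) - g z.
have [->|u0] := eqVneq u 0.
  rewrite normr0 mulr_ge0 //.
  have [|_] := dg (z + k); first by rewrite addrAC subrr add0r normr_gt0 k0 lexx.
  exact: le_trans.
(* The factor k^-1 cancels the k produced by differentiating along the segment, so that phi' =
   psi. *)
pose phi (t : R) := complex.Re (k^-1 * ip u (F (z + (t%:C)%C * k))).
pose psi (t : R) := complex.Re (ip u (g (z + (t%:C)%C * k))).
pose M := complex.Re (`|u| * (e * `|k|)).
have e0 : 0 <= e.
  have [|_] := dg (z + k); first by rewrite addrAC subrr add0r normr_gt0 k0 lexx.
  exact: le_trans.
have ME : ((M%:C)%C : R[i]) = `|u| * (e * `|k|).
  by rewrite RRe_real // ger0_real // !mulr_ge0.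
have dphi (t : R) : is_derive t (1 : R) phi (psi t).
  have := wirtinger_is_derive (t := t) (d := k) (z := z)
    (wirtingerZl k^-1 (wirtinger_ipl u (dF (z + (t%:C)%C * k)))).
  by rewrite scaler0 mulr0 addr0 mulrA mulfV // mul1r.
have dpsi (t : R) : 0 < t <= 1 -> exists2 d : R, is_derive t (1 : R) psi d & `|d| <= M.
  move=> /andP[t0 t1].
  have tC : (t%:C)%C != 0 :> R[i] by rewrite eq_complex /= eqxx andbT gt_eqF.
  have [|dgw hw] := dg (z + (t%:C)%C * k).
    rewrite addrAC subrr add0r normr_gt0 mulf_neq0 //=.
    rewrite normrM -[leRHS]mul1r ler_wpM2r // normc_def /= expr0n addr0 sqrtr_sqr.
    by rewrite gtr0_norm // lecR.
  eexists; first exact: (wirtinger_is_derive (d := k) (wirtinger_ipl u dgw)).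
  rewrite -lecR (le_trans (normc_ge_Re _)) // mulr0 addr0 ME normrM mulrC.
  by rewrite mulrA ler_wpM2r // (le_trans (CauchySchwarz ipl ipC ipn _ _)) // ler_wpM2l.
(* psi 1 - psi 0 is Re <u|u> = |u|^2, while [M] carries one factor |u|, which cancels. *)
have := derivative_variation dphi dpsi.
rewrite /psi mul1r mul0r addr0 -ReB -(ipBr ipl ipC) -/u ipn.
rewrite -lecR ME.
have -> : ((`|complex.Re (`|u| ^+ 2)|%:C)%C : R[i]) = `|u| * `|u|.
  have nu : `|u| ^+ 2 = ((complex.Re (`|u| ^+ 2))%:C)%C.
    by rewrite RRe_real // ger0_real // exprn_ge0.
  rewrite ger0_norm -?nu -?expr2 //.
  by rewrite -ler0c -nu exprn_ge0.
by rewrite ler_pM2l // normr_gt0.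
Qed.

(** A removable singularity for the derivative: subtracting (w - z) p from [g] leaves a function
    whose derivative is at most e near z and off z, so its increment is at most e |k|. The primitive
    [F] ties the value [g z] to the nearby ones. *)
Lemma derivable_of_primitive (F g h : R[i] -> H) (z : R[i]) (p : H) :
  (forall w, wirtinger F w (g w) 0) ->
  (\forall w \near (z : (R[i])^o)^', wirtinger g w (h w) 0) ->
  h w @[w --> (z : (R[i])^o)^'] --> p ->
  derivable (g : (R[i])^o -> H) z 1.
Proof.
move=> dF dg hp.
rewrite derivable_quotient.
suff : (fun k : (R[i])^o => k^-1 *: (g (k + z) - g z)) @ (0 : (R[i])^o)^' --> p.
  exact: cvgP.
apply/cvgrPdist_le => e e0.
have hp' : \forall w \near (z : (R[i])^o)^', `|p - h w| <= e.
  exact: (@cvgr_dist_le _ _ _ _ _ h).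
have : \forall w \near (z : (R[i])^o)^', wirtinger g w (h w) 0 /\ `|p - h w| <= e.
  exact: filterI.
rewrite near_withinE => /nbhs_ballP[r /= r0 hr].
rewrite near_withinE; apply/nbhs_ballP; exists r => //= k.
rewrite -ball_normE /= sub0r normrN => kr k0.
(* A primitive of w - z, so that the subtraction of (w - z) p from [g] is matched in [F]. *)
pose sq (w : R[i]) := 2^-1 * ((w - z) * (w - z)).
have did w : wirtinger (V := (R[i])^o) (fun w => w - z) w 1 0.
  exists (fun=> 1), (fun=> 0); split; [exact: cvg_cst|exact: cvg_cst|] => x.
  by rewrite scaler0 addr0 [x *: 1]mulr1 addrAC.
have dsq w : wirtinger (V := (R[i])^o) sq w (w - z) 0.
  have := wirtingerZl 2^-1 (wirtingerM (did w) (did w)).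
  rewrite mul0r mulr0 addr0 mul1r mulr1 scaler0.
  have -> : 2^-1 *: (w - z + (w - z) : (R[i])^o) = w - z; last by [].
  by rewrite -mulr2n -[X in _ *: X]mulr_natl; apply: mulKf; rewrite pnatr_eq0.
have := @primitive_derivative_variation (fun w => F w - sq w *: p)
  (fun w => g w - (w - z) *: p) (fun w => h w - p) z k e k0.
have dF' w : wirtinger (fun w => F w - sq w *: p) w (g w - (w - z) *: p) 0.
  have := wirtingerB (dF w) (wirtingerZ (dsq w) (wirtinger_cst p w)).
  by rewrite !scaler0 scale0r !addr0 subr0.
move=> /(_ dF').
have dg' w : 0 < `|w - z| <= `|k| ->
    wirtinger (fun w => g w - (w - z) *: p) w (h w - p) 0 /\ `|h w - p| <= e.
  move=> /andP[w0 wk]; have [||dgw hw] := hr w.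
  - by rewrite -ball_normE /= distrC (le_lt_trans wk).
  - by rewrite -subr_eq0 -normr_gt0.
  split; last by rewrite distrC.
  have := wirtingerB dgw (wirtingerZ (did w) (wirtinger_cst p w)).
  by rewrite !scaler0 scale0r scale1r !addr0 subr0.
move=> /(_ dg'); rewrite subrr scale0r subr0 [z + k - z]addrAC subrr add0r => le1.
rewrite [k + z]addrC.
have -> : p - k^-1 *: (g (z + k) - g z) = - (k^-1 *: (g (z + k) - k *: p - g z)).
  by rewrite addrAC [in RHS]scalerBr scalerA mulVf // scale1r opprB.
by rewrite normrN normrZ normfV mulrC ler_pdivrMr // normr_gt0.
Qed.

Lemma dn_inj (f : (R[i])^o -> H) z a b : derivs_independent f ->
  dn f a z = dn f b z -> a = b.
Proof.
move=> find ab; apply/eqP; apply: contraT => nab.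
have al : (a < (maxn a b).+1)%N by rewrite ltnS leq_maxl.
have bl : (b < (maxn a b).+1)%N by rewrite ltnS leq_maxr.
have := find z (maxn a b) (fun i => (i == Ordinal al)%:R - (i == Ordinal bl)%:R).
under eq_bigr do rewrite scalerBl.
rewrite sumrB (bigD1 (Ordinal al)) //= eqxx scale1r big1 => [|i /negbTE ->]; last first.
  by rewrite scale0r.
rewrite (bigD1 (Ordinal bl)) //= eqxx scale1r big1 => [|i /negbTE ->]; last first.
  by rewrite scale0r.
rewrite !addr0 ab subrr => /(_ erefl (Ordinal al)).
rewrite eqxx -val_eqE /= (negbTE nab) subr0 => /eqP.
by rewrite oner_eq0.
Qed.

Lemma dn_neq0 (f : (R[i])^o -> H) z a : derivs_independent f -> dn f a z != 0.
Proof.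
move=> find; apply/negP => /eqP a0.
have := find z a (fun i => (i == ord_max)%:R).
rewrite big_ord_recr /= eqxx a0 scaler0 addr0 big1 => [|i _].
  by move=> /(_ erefl ord_max) /eqP; rewrite eqxx oner_eq0.
by rewrite (_ : widen_ord _ _ == _ = false) ?scale0r // -val_eqE /= ltn_eqF.
Qed.

(* Where [dn f n] is not derivable, [dn f n.+1] takes the default value [point].
   By independence this value occurs for a single order at each point, so
   [dn f n.+1] is derivable there with nonzero derivative [dn f n.+2] and
   avoids [point] on a punctured neighbourhood, on which [dn f n] is therefore
   derivable with derivative tending to [point]. *)
Lemma dn_derivable (f : (R[i])^o -> H) : holomorphic f -> derivs_independent f ->
  forall n (z : (R[i])^o), derivable (dn f n : (R[i])^o -> H) z 1.
Proof.
move=> fhol find; elim=> [|n IH] z; first exact: fhol.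
have dnS m w : dn f m.+1 w = derive1 (dn f m : (R[i])^o -> H) w.
  by rewrite /dn derive1nS.
have dn_point m w : ~ derivable (dn f m : (R[i])^o -> H) w 1 -> dn f m.+1 w = point.
  by rewrite derivable_quotient dnS derive1_quotient; exact: dvgP.
have wdn m w : derivable (dn f m : (R[i])^o -> H) w 1 ->
    wirtinger (dn f m) w (dn f m.+1 w) 0.
  by move=> /wirtinger_derivable; rewrite dnS.
apply: contrapT => nd; have g_point := dn_point _ _ nd.
have dq : derivable (dn f n.+2 : (R[i])^o -> H) z 1.
  apply: contrapT => /dn_point; rewrite -g_point => /(dn_inj find) /eqP.
  by rewrite eqn_leq ltnn.
(* The induction hypothesis makes [dn f n] a primitive of [dn f n.+1] on the whole plane; the limit
   of the derivative is [dn f n.+2 z], by continuity of [dn f n.+2] at z. *)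
apply: nd; apply: (@derivable_of_primitive (dn f n) _ (dn f n.+2) _ (dn f n.+2 z)).
- by move=> w; apply: wdn; exact: IH.
- have : (fun k : (R[i])^o => k^-1 *: (dn f n.+2 (k + z) - dn f n.+2 z)) @ (0 : (R[i])^o)^' -->
      dn f n.+3 z by rewrite dnS derive1_quotient -derivable_quotient.
  move=> /cvgr_neq0 /(_ (dn_neq0 _ _ find)) nz.
  have := nz; rewrite !near_withinE => /nbhs_ballP[r /= r0 hr].
  apply/nbhs_ballP; exists r => //= w zw wz; apply: wdn; apply: contrapT => /dn_point wp.
  have /hr : ball (0 : (R[i])^o) r (w - z).
    by move: zw; rewrite -!ball_normE /= sub0r opprB.
  rewrite subr_eq0 => /(_ wz) /=.
  by rewrite subrK -!dnS wp -g_point subrr scaler0 eqxx.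
- exact: ((continuous_withinNx (dn f n.+2 : (R[i])^o -> H) z).1 (wirtinger_continuous (wdn _ _ dq))).
Qed.

End Smoothness.

(** * Integrals of lattice-periodic functions *)

Section PlaneMeasure.
Context {R : realType}.
Notation mu := (@lebesgue_measure R \x @lebesgue_measure R)%E.
Notation line := (measurableTypeR R).
Notation plane := (line * line)%type.

(** Measurability in the plane refers to the product of the sigma-algebras of the two lines, so an
    open set has to be a countable union of boxes; squares with rational centre and radius
    suffice. *)
Lemma open_plane_measurable (U : set (R * R)) :
  open U -> measurable (U : set plane).
Proof.
move=> oU.
pose box (q : rat * rat * rat) : set (R * R) :=
  ball (ratr q.1.1 : R) (ratr q.2 : R) `*` ball (ratr q.1.2 : R) (ratr q.2 : R).
have -> : U = \bigcup_q [set p | box q `<=` U /\ box q p].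
  apply/seteqP; split => p; last by move=> [q _ [qU]]; exact: qU.
  move=> Up; have /nbhs_ballP[e /= e0 eU] : nbhs p U by exact: open_nbhs_nbhs.
  have e20 : 0 < e / 2 by rewrite divr_gt0.
  (* With r < e / 2 and a rational centre within r of p, the square contains p and, having side 2 r
     < e, stays in the e-ball. *)
  have [r] := rat_in_itvoo e20; rewrite in_itv /= => /andP[r0 re].
  have /rat_in_itvoo[q1] : p.1 - ratr r < p.1 + ratr r by rewrite ltrD2l gtrN.
  have /rat_in_itvoo[q2] : p.2 - ratr r < p.2 + ratr r by rewrite ltrD2l gtrN.
  rewrite !in_itv /= => /andP[a2 b2] /andP[a1 b1].
  have d1 : `|p.1 - ratr q1| < ratr r by rewrite ltr_norml; lra.
  have d2 : `|p.2 - ratr q2| < ratr r by rewrite ltr_norml; lra.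
  exists (q1, q2, r) => //; split.
    move=> x [/=]; rewrite -!ball_normE /= => x1 x2; apply: eU; split=> /=.
      rewrite -ball_normE /= (le_lt_trans (ler_distD (ratr q1) _ _)) //.
      by move: d1 x1 re; lra.
    rewrite -ball_normE /= (le_lt_trans (ler_distD (ratr q2) _ _)) //.
    by move: d2 x2 re; lra.
  by split; rewrite /= -ball_normE /= distrC.
apply: countable_bigcupT_measurable; first exact: countableP.
move=> q; have [qU|nqU] := pselect (box q `<=` U); last first.
  by rewrite [X in measurable X](_ : _ = set0) //; apply/seteqP; split => // p [].
rewrite [X in measurable X](_ : _ = box q); last by apply/seteqP; split => // p [].
by apply: measurableX; exact: measurable_ball.
Qed.

Lemma continuous_plane_measurable (f : R * R -> R) : continuous f ->
  measurable_fun setT (f : plane -> line).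
Proof.
move=> /continuousP cf; apply: (measurability _ (RGenOpens.measurableE R)).
move=> _ [_ [a [b ->] <-]]; rewrite setTI; apply: open_plane_measurable.
exact/cf/interval_open.
Qed.

Lemma measurable_translation (a : R) : measurable_fun setT ((fun x : R => x + a) : line -> line).
Proof. exact: measurable_funD. Qed.

(** The pushforward under the translation agrees with Lebesgue measure on half-open intervals, which
    determine it. *)
Lemma lebesgue_translation (a : R) (A : set line) : measurable A ->
  lebesgue_measure ((fun x : R => x + a) @^-1` A) = lebesgue_measure A.
Proof.
move=> mA; apply/esym.
apply: (@lebesgue_measure_unique R (measure_function_pushforward__canonical__measure_function_Measure
  (@lebesgue_measure R) (measurable_translation a))) => //=.
move=> _ [[x y] _ <-]; rewrite /pushforward.
have -> : (fun x : R => x + a) @^-1` `]x, y]%classic = `]x - a, y - a]%classic.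
  by apply/seteqP; split => t /=; rewrite !in_itv /= ltrBlDr lerBrDr.
by rewrite !lebesgue_measure_itv /= !lte_fin ltrD2r -!EFinB opprB addrA subrK.
Qed.

Definition translate (a p : R * R) : R * R := (p.1 + a.1, p.2 + a.2).

Lemma measurable_translate a : measurable_fun setT (translate a : plane -> plane).
Proof.
apply: measurable_fun_pair.
  by apply: (measurableT_comp (measurable_translation a.1)); exact: (@measurable_fst _ _ line line).
by apply: (measurableT_comp (measurable_translation a.2)); exact: (@measurable_snd _ _ line line).
Qed.

Lemma plane_translation a (A : set plane) : measurable A ->
  mu (translate a @^-1` A) = mu A.
Proof.
move=> mA; apply/esym.
have := @product_measure_unique _ _ (measurableTypeR R) (measurableTypeR R) R
  (@lebesgue_measure R) (@lebesgue_measure R)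
  (measure_function_pushforward__canonical__measure_function_Measure
  mu (measurable_translate a)).
move=> /(_ _ A mA); apply => X Y mX mY; rewrite /= /pushforward.
have -> : translate a @^-1` (X `*` Y) =
    ((fun x => x + a.1) @^-1` X) `*` ((fun x => x + a.2) @^-1` Y) by [].
have mp (Z : set line) (b : R) : measurable Z -> measurable (((fun x => x + b) : line -> line) @^-1` Z).
  by move=> mZ; rewrite -[X in measurable X]setTI; exact: measurable_translation.
rewrite product_measure1E; [|exact: mp|exact: mp].
by congr (_ * _)%E; exact: lebesgue_translation.
Qed.

Lemma ge0_integral_translate a (D : set plane) (F : plane -> \bar R) :
  measurable D -> measurable_fun setT F ->
  (forall p, (0 <= F p)%E) ->
  (\int[mu]_(p in (translate a : plane -> plane) @^-1` D) F (translate a p) = \int[mu]_(p in D) F p)%E.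
Proof.
move=> mD mF F0.
have := @ge0_integral_pushforward _ _ _ _ R _ (measurable_translate a) mu D F mD
  (measurable_funTS mF) (fun y _ => F0 y).
move=> <-.
apply: (eq_measure_integral _ (m1 := measure_function_pushforward__canonical__measure_function_Measure
  mu (measurable_translate a))) => A mA _.
exact: plane_translation.
Qed.

Definition ofC (l : R[i]) : R * R := (complex.Re l, complex.Im l).

Lemma toC_translate (l : R[i]) p : toC (translate (ofC l) p) = toC p + l.
Proof. by case: l p => a b [x y]. Qed.

Lemma translateN (l : R[i]) p : translate (ofC (- l)) (translate (ofC l) p) = p.
Proof. by case: l p => a b [x y]; rewrite /translate /= !addrK. Qed.

Lemma translateK (l : R[i]) p : translate (ofC l) (translate (ofC (- l)) p) = p.
Proof. by have := translateN (- l) p; rewrite opprK. Qed.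

Lemma toC_inj : injective (@toC R).
Proof. by move=> [x y] [x' y'] [-> ->]. Qed.

Section Lattice.
Variables (w1 w2 : R[i]).
Hypothesis w12 : lattice_basis w1 w2.
Notation L := (lattice w1 w2).

Definition lattice_vector (x : int * int) : R[i] := x.1%:~R * w1 + x.2%:~R * w2.

Lemma lattice_vectorP x : L (lattice_vector x).
Proof. by exists x.1, x.2. Qed.

Lemma latticeN l : L l -> L (- l).
Proof.
move=> [m [k ->]]; exists (- m), (- k).
by rewrite !rmorphN !mulNr opprD.
Qed.

(** Cramer's rule with determinant Im (conj w1 w2). Injectivity keeps distinct indices from
    producing the same piece of a domain. *)
Lemma lattice_vector_inj : injective lattice_vector.
Proof.
have free (a b : R) : (a%:C)%C * w1 + (b%:C)%C * w2 = 0 -> a = 0 /\ b = 0.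
  move: w12; rewrite /lattice_basis.
  case: w1 w2 => [x1 y1] [x2 y2] /= d0 [E1 E2].
  have e1 : a * x1 + b * x2 = 0 by rewrite -E1; ring.
  have e2 : a * y1 + b * y2 = 0 by rewrite -E2; ring.
  split; apply: (mulIf d0); rewrite mul0r.
    by transitivity (y2 * (a * x1 + b * x2) - x2 * (a * y1 + b * y2)); [ring|rewrite e1 e2; ring].
  by transitivity (x1 * (a * y1 + b * y2) - y1 * (a * x1 + b * x2)); [ring|rewrite e1 e2; ring].
move=> [m k] [m' k'] /= E.
have iC (n : int) : (n%:~R : R[i]) = ((n%:~R : R)%:C)%C by rewrite rmorph_int.
have := free (m - m')%:~R (k - k')%:~R.
rewrite -!iC !rmorphB !mulrBl addrACA -opprD.
have -> : m%:~R * w1 + k%:~R * w2 = m'%:~R * w1 + k'%:~R * w2 by exact: E.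
rewrite subrr => /(_ erefl) [/eqP + /eqP].
by rewrite !subr_eq0 !eqr_int => /eqP -> /eqP ->.
Qed.

(* The lattice translates of each domain cut the other one into countably many
   pieces, and the pieces of D and D' correspond by translation. *)
Lemma ge0_integral_fundamental_domain (D D' : set plane) (F : plane -> \bar R) :
  fundamental_domain L D -> fundamental_domain L D' ->
  measurable_fun setT F -> (forall p, (0 <= F p)%E) ->
  (forall l p, L l -> F (translate (ofC l) p) = F p) ->
  (\int[mu]_(p in D) F p = \int[mu]_(p in D') F p)%E.
Proof.
move=> [mD0 repD] [mD0' repD'] mF F0 FL.
have mD : measurable (D : set plane) := mD0.
have mD' : measurable (D' : set plane) := mD0'.
have rep_inj (X : set (R * R)) : (forall z, exists! p, X p /\ L (z - toC p)) ->
    forall z p q, X p -> X q -> L (z - toC p) -> L (z - toC q) -> p = q.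
  by move=> repX z p q Xp Xq zp zq; have [r [_ ru]] := repX z; rewrite -(ru p) ?(ru q).
have mT (X : set plane) a : measurable X -> measurable ((translate a : plane -> plane) @^-1` X).
  by move=> mX; rewrite -[X in measurable X]setTI; exact: measurable_translate.
(* Integer pairs are enumerated by naturals; a natural that decodes to nothing indexes an empty
   piece. *)
have [code [dec [codeK decK]]] : exists (code : int * int -> nat) (dec : nat -> option (int * int)),
    (forall x, dec (code x) = Some x) /\ (forall i x, dec i = Some x -> code x = i).
  exists pickle, pickle_inv; split; first exact: pickleK_inv.
  by move=> i x ix; have := pickle_invK (T := (int * int)%type) i; rewrite ix.
pose E i : set plane := if dec i is Some x then
  D `&` (translate (ofC (lattice_vector x)) : plane -> plane) @^-1` D' else set0.
pose E' i : set plane := if dec i is Some x then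
  D' `&` (translate (ofC (- lattice_vector x)) : plane -> plane) @^-1` D else set0.
have mE i : measurable (E i).
  by rewrite /E; case: (dec _) => // x; apply: measurableI => //; exact: mT.
have mE' i : measurable (E' i).
  by rewrite /E'; case: (dec _) => // x; apply: measurableI => //; exact: mT.
have DE : D = \bigcup_i E i.
  apply/seteqP; split => [p Dp|p [i _]]; last by rewrite /E; case: (dec _) => // x [].
  have [q [[D'q [m [k pq]]] _]] := repD' (toC p).
  exists (code (- m, - k)) => //; rewrite /E codeK; split => //=.
  have -> : translate (ofC (lattice_vector (- m, - k))) p = q; last by [].
  apply: toC_inj; rewrite toC_translate /lattice_vector /= !rmorphN !mulNr -opprD -pq.
  by rewrite opprB addrC subrK.
have DE' : D' = \bigcup_i E' i.
  apply/seteqP; split => [p Dp|p [i _]]; last by rewrite /E'; case: (dec _) => // x [].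
  have [q [[Dq [m [k pq]]] _]] := repD (toC p).
  exists (code (m, k)) => //; rewrite /E' codeK; split => //=.
  have -> : translate (ofC (- lattice_vector (m, k))) p = q; last by [].
  apply: toC_inj; rewrite toC_translate /lattice_vector /= -pq.
  by rewrite opprB addrC subrK.
(* A point has a single representative in D' modulo the lattice, so only one lattice vector carries
   it into D'. *)
have tE : trivIset setT E.
  apply/trivIsetP => i j _ _ ij; rewrite -subset0 => p [].
  rewrite /E; case Ei : (dec i) => [x|] //; case Ej : (dec j) => [y|] //.
  move: ij; rewrite -(decK _ _ Ei) -(decK _ _ Ej).
  move=> /eqP ij [Dp px] [_ py]; apply: ij; congr code.
  apply: lattice_vector_inj; apply: (addrI (toC p)); rewrite -!toC_translate; congr toC.
  apply: (rep_inj _ repD' (toC p)) => //.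
    by rewrite toC_translate opprD addrA subrr sub0r; exact/latticeN/lattice_vectorP.
  by rewrite toC_translate opprD addrA subrr sub0r; exact/latticeN/lattice_vectorP.
have tE' : trivIset setT E'.
  apply/trivIsetP => i j _ _ ij; rewrite -subset0 => p [].
  rewrite /E'; case Ei : (dec i) => [x|] //; case Ej : (dec j) => [y|] //.
  move: ij; rewrite -(decK _ _ Ei) -(decK _ _ Ej).
  move=> /eqP ij [Dp px] [_ py]; apply: ij; congr code.
  apply: lattice_vector_inj; apply: oppr_inj.
  apply: (addrI (toC p)); rewrite -!toC_translate; congr toC.
  apply: (rep_inj _ repD (toC p)) => //.
    by rewrite toC_translate opprD addrA subrr sub0r opprK; exact: lattice_vectorP.
  by rewrite toC_translate opprD addrA subrr sub0r opprK; exact: lattice_vectorP.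
rewrite DE DE' !ge0_integral_bigcup //; try by move=> ? _; exact: F0.
- apply: eq_eseriesr => i _; rewrite /E /E'; case: (dec _) => [x|]; last by rewrite !integral_set0.
  have mX := measurableI _ _ mD' (mT D (ofC (- lattice_vector x)) mD).
  rewrite -(ge0_integral_translate (ofC (lattice_vector x)) mX mF F0).
  (* Pulling the piece of D' back along the lattice vector gives the matching piece of D, and
     periodicity leaves [F] unchanged. *)
  rewrite [X in _ = integral _ X _](_ : _ =
      D `&` (translate (ofC (lattice_vector x)) : plane -> plane) @^-1` D'); last first.
    by apply/seteqP; split => p /=; rewrite translateN => -[].
  by apply: eq_integral => p _; rewrite FL //; exact: lattice_vectorP.
- exact: measurable_funTS.
- exact: measurable_funTS.
Qed.

End Lattice.
End PlaneMeasure.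

(** * Finiteness, translation and derivatives under the integral over a fundamental domain *)

Section TorusIntegral.
Context {R : realType}.
Notation mu := (@lebesgue_measure R \x @lebesgue_measure R)%E.
Notation line := (measurableTypeR R).
Notation plane := (line * line)%type.
Variables (w1 w2 : R[i]).
Hypothesis w12 : lattice_basis w1 w2.
Notation L := (lattice w1 w2).

Lemma measurable_linear_form (a b : R) :
  measurable_fun setT ((fun p => p.1 * a + p.2 * b) : plane -> line).
Proof.
apply: measurable_funD; apply: measurable_funM; try exact: measurable_cst.
  exact: (@measurable_fst _ _ line line).
exact: (@measurable_snd _ _ line line).
Qed.

Let vol := complex.Im (conjc w1 * w2).
(** [s] and [t] are the real coordinates in the basis w1, w2, by Cramer's rule with determinant
    [vol]. *)
Let s (z : R[i]) := complex.Re z * (complex.Im w2 / vol) + complex.Im z * (- complex.Re w2 / vol).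
Let t (z : R[i]) := complex.Re z * (- complex.Im w1 / vol) + complex.Im z * (complex.Re w1 / vol).

Let volE : vol = complex.Re w1 * complex.Im w2 - complex.Im w1 * complex.Re w2.
Proof. by rewrite /vol; case: w1 w2 => [x1 y1] [x2 y2] /=; ring. Qed.

Let sB z w : s (z - w) = s z - s w.
Proof. by rewrite /s; case: z w => [x y] [x' y'] /=; ring. Qed.

Let tB z w : t (z - w) = t z - t w.
Proof. by rewrite /t; case: z w => [x y] [x' y'] /=; ring. Qed.

Let intC (n : int) : (n%:~R : R[i]) = ((n%:~R : R)%:C)%C.
Proof. by rewrite rmorph_int. Qed.

Let s_lattice (m k : int) : s (m%:~R * w1 + k%:~R * w2) = m%:~R.
Proof.
have := w12; rewrite /lattice_basis -/vol /s !intC volE.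
by case: w1 w2 => [x1 y1] [x2 y2] /= d0; field.
Qed.

Let t_lattice (m k : int) : t (m%:~R * w1 + k%:~R * w2) = k%:~R.
Proof.
have := w12; rewrite /lattice_basis -/vol /t !intC volE.
by case: w1 w2 => [x1 y1] [x2 y2] /= d0; field.
Qed.

Let stE z : z = ((s z)%:C)%C * w1 + ((t z)%:C)%C * w2.
Proof.
have := w12; rewrite /lattice_basis -/vol /s /t volE.
case: w1 w2 z => [x1 y1] [x2 y2] [x y] /= d0.
by apply/eqP; rewrite eq_complex /=; apply/andP; split; apply/eqP; field.
Qed.

(** A bounded reference domain: D may be unbounded, and the finiteness of its measure, like the
    bounds on periodic functions, is obtained by comparison with this one. *)
Definition parallelogram : set plane :=
  [set p | 0 <= s (toC p) < 1 /\ 0 <= t (toC p) < 1].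

Lemma parallelogram_fundamental : fundamental_domain L parallelogram.
Proof.
split.
  have mS : measurable_fun setT ((fun p => s (toC p)) : plane -> line).
    exact: measurable_linear_form.
  have mT : measurable_fun setT ((fun p => t (toC p)) : plane -> line).
    exact: measurable_linear_form.
  have -> : parallelogram = ((fun p => s (toC p)) : plane -> line) @^-1` `[0, 1[%classic `&`
      ((fun p => t (toC p)) : plane -> line) @^-1` `[0, 1[%classic.
    by apply/seteqP; split => p /=; rewrite /parallelogram /= !in_itv.
  apply: measurableI; rewrite -[X in measurable X]setTI.
    by apply: mS => //; exact: measurable_itv.
  by apply: mT => //; exact: measurable_itv.
move=> z; pose l := (Num.floor (s z))%:~R * w1 + (Num.floor (t z))%:~R * w2.
exists (ofC (z - l)).
have toCK w : toC (ofC w) = w by case: w.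
split.
  split; last by rewrite toCK opprB addrC subrK; do 2 eexists.
  rewrite /parallelogram /= toCK sB tB s_lattice t_lattice.
  have := floor_itv (s z); have := floor_itv (t z); rewrite !intrD.
  by move=> /andP[a b] /andP[c d]; split; apply/andP; split; lra.
move=> q [[/andP[sq0 sq1] /andP[tq0 tq1]] [m [k zq]]].
apply: toC_inj; rewrite toCK.
have E : toC q = z - (m%:~R * w1 + k%:~R * w2) by rewrite -zq opprB addrC subrK.
move: sq0 sq1 tq0 tq1; rewrite E sB tB s_lattice t_lattice => a b c d.
rewrite /l; congr (z - (_ * _ + _ * _)); congr (_%:~R); apply: floor_def.
  by apply/andP; split; rewrite ?intrD; lra.
by apply/andP; split; rewrite ?intrD; lra.
Qed.

Lemma parallelogram_bounded : exists2 M : R, 0 <= M &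
  forall p, parallelogram p -> `|p.1| <= M /\ `|p.2| <= M.
Proof.
exists (`|complex.Re w1| + `|complex.Re w2| + (`|complex.Im w1| + `|complex.Im w2|)).
  by rewrite !addr_ge0.
move=> p [/andP[a b] /andP[c d]].
have := stE (toC p); move: (s _) (t _) a b c d => x y a b c d /eqP.
rewrite eq_complex => /andP[/eqP + /eqP].
case: w1 w2 => [x1 y1] [x2 y2] /= -> ->.
have bnd (u v : R) : `|x * u + y * v| <= `|u| + `|v|.
  rewrite (le_trans (ler_normD _ _)) // !normrM (ger0_norm a) (ger0_norm c).
  by apply: lerD; rewrite -[leRHS]mul1r ler_wpM2r // ltW.
split.
  have -> : x * x1 - 0 * y1 + (y * x2 - 0 * y2) = x * x1 + y * x2 by ring.
  by rewrite (le_trans (bnd _ _)) // lerDl addr_ge0.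
have -> : x * y1 + 0 * x1 + (y * y2 + 0 * x2) = x * y1 + y * y2 by ring.
by rewrite (le_trans (bnd _ _)) // lerDr addr_ge0.
Qed.

Definition box (M : R) : set (R * R) := `[- M, M]%classic `*` `[- M, M]%classic.

Lemma parallelogram_box : exists2 M : R, 0 <= M & parallelogram `<=` box M.
Proof.
have [M M0 PM] := parallelogram_bounded; exists M => // p /PM[p1 p2].
by split; rewrite /= in_itv /= -ler_norml.
Qed.

Lemma periodic_bounded (f : R * R -> R) : continuous f ->
  (forall l p, L l -> f (translate (ofC l) p) = f p) ->
  exists2 B : R, 0 <= B & forall p, `|f p| <= B.
Proof.
move=> cf pf; have [M M0 PM] := parallelogram_box.
have cbox : compact (box M) by apply: compact_setX; exact: segment_compact.
have cimg : compact (f @` box M).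
  apply: continuous_compact => //; exact: continuous_subspaceT.
have [B [_ HB]] := compact_bounded cimg.
have HB' p : box M p -> `|f p| <= `|B| + 1.
  by move=> bp; apply: HB; [rewrite (le_lt_trans (ler_norm B)) // ltrDl|exists p].
exists (`|B| + 1); first by rewrite addr_ge0.
move=> p; have [_ repP] := parallelogram_fundamental.
have [q [[Pq Lq] _]] := repP (toC p).
have -> : p = translate (ofC (toC p - toC q)) q.
  by apply: toC_inj; rewrite toC_translate addrC subrK.
by rewrite pf //; exact/HB'/PM.
Qed.

Variable D : set (R * R).
Hypothesis fD : fundamental_domain L D.
Let mD : measurable (D : set plane) := fD.1.

Lemma fundamental_domain_finite : (mu D < +oo)%E.
Proof.
have mP : measurable parallelogram := parallelogram_fundamental.1.
have muE (X : set plane) : measurable X -> (\int[mu]_(p in X) 1%E = mu X)%E.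
  by move=> mX; rewrite integral_cst // mul1e.
rewrite -muE //.
rewrite (@ge0_integral_fundamental_domain R w1 w2 w12 _ _ (cst 1%E) fD parallelogram_fundamental) //.
rewrite muE //; have [M M0 PM] := parallelogram_box.
have mB : measurable (box M : set plane).
  by apply: measurableX; exact: measurable_itv.
have mPB : (mu parallelogram <= mu (box M))%E by apply: le_measure => //; rewrite inE.
rewrite (le_lt_trans mPB) //.
rewrite product_measure1E; [|exact: measurable_itv|exact: measurable_itv].
have [r rE] : exists r : R, lebesgue_measure (`[- M, M]%classic : set line) = r%:E.
  rewrite lebesgue_measure_itv /=; case: ifP => _; last by exists 0.
  by exists (M - - M); rewrite EFinB.
change (lebesgue_measure (`[(- M)%R, M]%classic : set line) *
  lebesgue_measure (`[(- M)%R, M]%classic : set line) < +oo)%E.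
by rewrite rE -EFinM ltry.
Qed.

Lemma bounded_integrable (f : plane -> line) (B : R) : measurable_fun setT f ->
  (forall p, `|f p| <= B) -> mu.-integrable D (EFin \o f).
Proof.
move=> mf fB; apply: measurable_bounded_integrable => //.
- exact: fundamental_domain_finite.
- exact: measurable_funTS.
- exists B; split; first exact: num_real.
  by move=> x Bx p _; exact: le_trans (fB p) (ltW Bx).
Qed.

Lemma fundamental_domain_translate (a : R[i]) :
  fundamental_domain L ((translate (ofC (- a)) : plane -> plane) @^-1` D).
Proof.
split.
  have : measurable ((translate (ofC (- a)) : plane -> plane) @^-1` D).
    by rewrite -[X in measurable X]setTI; exact: measurable_translate.
  by [].
move=> z; have [p [[Dp zp] up]] := fD.2 (z - a).
exists (translate (ofC a) p); split.
  split; first by rewrite /= translateN.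
  by rewrite toC_translate opprD addrA addrAC.
move=> q [/= Dq zq]; rewrite (up (translate (ofC (- a)) q)) ?translateK //.
split=> //; rewrite toC_translate opprB addrA subrK //.
Qed.

(** A translate of D is again a fundamental domain, so a periodic function has the same integral
    over it; invariance of the measure then moves the translation into the integrand. *)
Lemma ge0_integral_periodic_translate (a : R[i]) (F : plane -> \bar R) :
  measurable_fun setT F -> (forall p, (0 <= F p)%E) ->
  (forall l p, L l -> F (translate (ofC l) p) = F p) ->
  (\int[mu]_(p in D) F (translate (ofC a) p) = \int[mu]_(p in D) F p)%E.
Proof.
move=> mF F0 pF.
have fa := fundamental_domain_translate a.
rewrite (ge0_integral_fundamental_domain w12 fD fa mF F0 pF).
rewrite -(ge0_integral_translate (ofC a) fa.1 mF F0).
congr integral; apply/seteqP; split => p /=; by rewrite translateN.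
Qed.

Lemma integral_periodic_translate (a : R[i]) (f : R * R -> R) : continuous f ->
  (forall l p, L l -> f (translate (ofC l) p) = f p) ->
  (\int[mu]_(p in D) (f (translate (ofC a) p))%:E = \int[mu]_(p in D) (f p)%:E)%E.
Proof.
move=> cf pf.
have mf : measurable_fun setT (EFin \o f : plane -> \bar R).
  by apply/measurable_EFinP; exact: continuous_plane_measurable.
rewrite integralE [RHS]integralE; congr (_ - _)%E.
  have H := @ge0_integral_periodic_translate a _ (measurable_funepos mf)
    (fun p => funepos_ge0 _ p).
  etransitivity; last first.
    by apply: H => l p Ll; rewrite !funeposE /= pf.
  by apply: eq_integral => p _; rewrite !funeposE.
have H := @ge0_integral_periodic_translate a _ (measurable_funeneg mf)
  (fun p => funeneg_ge0 _ p).
etransitivity; last first.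
  by apply: H => l p Ll; rewrite !funenegE /= pf.
by apply: eq_integral => p _; rewrite !funenegE.
Qed.

(* Y is the bounded limit of difference quotients of X, whose integrals vanish
   by translation invariance. *)
Lemma integral_derivative_periodic (d : R[i]) (X Y : R * R -> R) :
  continuous X -> continuous Y ->
  (forall l p, L l -> X (translate (ofC l) p) = X p) ->
  (forall l p, L l -> Y (translate (ofC l) p) = Y p) ->
  (forall p (t : R), is_derive t (1 : R)
    (fun t : R => X (translate (ofC ((t%:C)%C * d)) p))
    (Y (translate (ofC ((t%:C)%C * d)) p))) ->
  (\int[mu]_(p in D) (Y p)%:E = 0)%E.
Proof.
move=> cX cY pX pY dX.
have [B B0 YB] := periodic_bounded cY pY.
pose shift n p := translate (ofC ((((n.+1%:R)^-1 : R)%:C)%C * d)) p.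
pose q n p : R := n.+1%:R * (X (shift n p) - X p).
have t0 p : translate (ofC (((0 : R)%:C)%C * d)) p = p.
  by rewrite mul0r; case: p => x y; rewrite /translate /= !addr0.
(* The mean value theorem makes each quotient a value of [Y], so the bound on [Y] dominates all
   quotients at once. *)
have qB n p : `|q n p| <= B.
  have h0 : 0 < (n.+1%:R : R)^-1 by rewrite invr_gt0 ltr0n.
  have [|c _ E] := MVT_segment (ltW h0) (fun t _ => dX p t).
    by apply: derivable_within_continuous => x _; exact: ex_derive.
  rewrite /q; move: E; rewrite t0 subr0 => ->.
  by rewrite mulrCA divff ?mulr1 ?pnatr_eq0.
have qY p : q n p @[n --> \oo] --> Y p.
  have := dX p 0; rewrite t0 => -[der val].
  have lim : (fun h : R => h^-1 *: (X (translate (ofC ((h%:C)%C * d)) p) - X p)) @ 0^' --> Y p.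
    rewrite -val /derive; move: der; rewrite /derivable /= t0.
    by under eq_fun do rewrite /= addr0 [_ *: 1]mulr1.
  have hn : ((n.+1%:R)^-1 : R) @[n --> \oo] --> (0 : R)^'.
    move=> P; rewrite /dnbhs /within /= => P0.
    have hP : \forall n \near \oo, (n.+1%:R^-1 : R) != 0 -> P n.+1%:R^-1.
      exact: (@cvg_harmonic R _ P0).
    by apply: filterS hP => n; apply; rewrite invr_eq0 pnatr_eq0.
  have := cvg_comp _ _ hn lim.
  by apply: cvg_trans; apply: near_eq_cvg; apply: nearW => n /=; rewrite invrK.
have mX : measurable_fun setT (X : plane -> line) := continuous_plane_measurable cX.
have mq n : measurable_fun setT (q n : plane -> line).
  apply: measurable_funM; first exact: measurable_cst.
  apply: measurable_funB => //.
  exact: (measurableT_comp mX (measurable_translate _)).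
have mEFin (h : plane -> line) : measurable_fun setT h ->
    measurable_fun D (EFin \o h : plane -> \bar R).
  by move=> mh; apply: measurable_funTS; apply/measurable_EFinP.
have [] := @dominated_convergence _ plane R mu D mD (fun n p => (q n p)%:E) (fun p => (Y p)%:E)
  (cst B%:E).
- by move=> n; exact: mEFin.
- by apply: mEFin; exact: continuous_plane_measurable.
- by apply: aeW => p _; apply/cvg_EFin; [near=> n|exact: qY].
- by apply: (@bounded_integrable (cst B) B) => // p; rewrite ger0_norm.
- by apply: aeW => p n _; rewrite /= lee_fin.
move=> _ _ lim.
have q0 n : (\int[mu]_(p in D) (q n p)%:E = 0)%E.
  have [C C0 XC] := periodic_bounded cX pX.
  have iX := bounded_integrable mX XC.
  have iXs : mu.-integrable D (EFin \o (fun p => X (shift n p))).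
    apply: (@bounded_integrable _ C) => [|p]; last exact: XC.
    exact: (measurableT_comp mX (measurable_translate _)).
  transitivity (\int[mu]_(p in D) (n.+1%:R%:E * ((X (shift n p))%:E - (X p)%:E)))%E.
    by apply: eq_integral => p _; rewrite -EFinB -EFinM.
  rewrite integralZl //; last exact: integrableB.
  rewrite integralB_EFin // integral_periodic_translate // subee ?mule0 //.
  exact: integral_fune_fin_num iX.
move: lim; under eq_fun do rewrite q0.
by move=> /(cvg_unique _ (cvg_cst _)) => <-.
Unshelve. all: by end_near. Qed.

End TorusIntegral.

(** * Real differentiability and continuity on the plane *)

Section Differentiable.
Context {R : realType}.
Notation C := (R[i])^o.

Definition wdiff (V : normedModType R[i]) (u : R[i] -> V) :=
  forall z, exists A B, wirtinger u z A B.

Lemma wdiffD (V : normedModType R[i]) (u v : R[i] -> V) :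
  wdiff u -> wdiff v -> wdiff (fun z => u z + v z).
Proof.
move=> du dv z; have [A [B uz]] := du z; have [A' [B' vz]] := dv z.
by do 2 eexists; exact: wirtingerD uz vz.
Qed.

Lemma wdiffB (V : normedModType R[i]) (u v : R[i] -> V) :
  wdiff u -> wdiff v -> wdiff (fun z => u z - v z).
Proof.
move=> du dv z; have [A [B uz]] := du z; have [A' [B' vz]] := dv z.
by do 2 eexists; exact: wirtingerB uz vz.
Qed.

Lemma wdiffZ (V : normedModType R[i]) (c : R[i] -> R[i]) (u : R[i] -> V) :
  wdiff (V := C) c -> wdiff u -> wdiff (fun z => c z *: u z).
Proof.
move=> dc du z; have [A [B cz]] := dc z; have [A' [B' uz]] := du z.
by do 2 eexists; exact: wirtingerZ cz uz.
Qed.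

Lemma wdiffV (c : R[i] -> R[i]) : (forall z, c z != 0) ->
  wdiff (V := C) c -> wdiff (V := C) (fun z => (c z)^-1).
Proof.
move=> c0 dc z; have [A [B cz]] := dc z.
by do 2 eexists; exact: (wirtingerV c0 cz).
Qed.

Lemma wdiff_cst (V : normedModType R[i]) (v : V) : wdiff (fun=> v).
Proof. by move=> z; do 2 eexists; exact: wirtinger_cst. Qed.

Lemma continuous_toC : continuous (@toC R : R * R -> C).
Proof.
move=> p; apply/(@cvgrPdist_le R[i] C) => e e0.
have eE : e = ((complex.Re e)%:C)%C by rewrite RRe_real // realE ltW.
(* Half of e for each coordinate: the plane carries the sup norm, and |x + iy| <= |x| + |y|. *)
have e2 : 0 < complex.Re e / 2 by rewrite divr_gt0 // -ltcR -eE.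
suff : nbhs (p : (R * R)%type) [set q | `|toC p - toC q| <= e] by [].
apply/nbhs_ballP; exists (complex.Re e / 2) => //= q [].
rewrite -!ball_normE /= => q1 q2; rewrite eE.
have -> : toC p - toC q = ((p.1 - q.1)%:C)%C + 'i%C * ((p.2 - q.2)%:C)%C.
  by apply/eqP; rewrite eq_complex /=; apply/andP; split; apply/eqP; ring.
rewrite (le_trans (ler_normD _ _)) // normrM.
have nR (x : R) : `|(x%:C)%C : R[i]| = (`|x|%:C)%C.
  by rewrite normc_def /= expr0n addr0 sqrtr_sqr.
have -> : `|'i%C : R[i]| = 1 by rewrite normc_def /= expr0n expr1n add0r sqrtr1.
rewrite mul1r !nR -rmorphD /= lecR.
by move: q1 q2; lra.
Qed.

Lemma continuous_Re_toC (F : R[i] -> R[i]) : wdiff (V := C) F ->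
  continuous (fun p => complex.Re (F (toC p))).
Proof.
move=> dF p; have [A [B Fz]] := dF (toC p).
have cF : (F : C -> C) (toC q) @[q --> p] --> (F (toC p) : C).
  exact: (cvg_comp _ _ (@continuous_toC p) (wirtinger_continuous Fz)).
apply/cvgrPdist_le => e e0; have e0' : 0 < (e%:C)%C :> R[i] by rewrite ltcR.
move/(@cvgrPdist_le R[i] C) : cF => /(_ _ e0'); apply: filterS => q le1.
by rewrite -ReB -lecR (le_trans (normc_ge_Re _)).
Qed.

End Differentiable.

(** * Integrals of the norm ratios *)

Section TodaIdentity.
Context {R : realType} {H : normedModType R[i]} (ip : H -> H -> R[i]).
Hypothesis ipl : forall a u v w, ip (a *: u + v) w = a^* * ip u w + ip v w.
Hypothesis ipC : forall u v, ip u v = (ip v u)^*.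
Hypothesis ipn : forall v, ip v v = `|v| ^+ 2.
Variables (g v : nat -> R[i] -> H).
Hypothesis g_free : forall z n (c : 'I_n.+1 -> R[i]),
  \sum_(k < n.+1) c k *: g k z = 0 -> forall k, c k = 0.
Hypothesis vE : forall n z, v n z = g n z - orth_proj ip (g^~ z) n (g n z).
Hypothesis dg : forall n z, wirtinger (g n) z (g n.+1 z) 0.
Variables (w1 w2 : R[i]) (D : set (R * R)).
Hypothesis w12 : lattice_basis w1 w2.
Hypothesis fD : fundamental_domain (lattice w1 w2) D.
Hypothesis g_quasi : forall l, lattice w1 w2 l ->
  exists (c c' : R[i] -> R[i]) (T : H -> H),
  [/\ forall z, c z != 0, forall z, wirtinger (V := (R[i])^o) c z (c' z) 0,
    forall a u v, T (a *: u + v) = a *: T u + T v,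
    forall u v, ip (T u) (T v) = ip u v & forall z, g 0 (z + l) = c z *: T (g 0 z)].
Notation mu := (@lebesgue_measure R \x @lebesgue_measure R)%E.
Notation C := (R[i])^o.
Notation alpha := (norm_ratio ip v).
Notation ell := (subdiag ip g v).

Let S0 := sqnorm_neq0 ipl ipC ipn g_free vE.

Lemma wdiff_ip (u w : R[i] -> H) : wdiff u -> wdiff w ->
  wdiff (V := C) (fun z => ip (u z) (w z)).
Proof.
move=> du dw z; have [A [B uz]] := du z; have [A' [B' wz]] := dw z.
by do 2 eexists; exact: (wirtinger_ip ipl ipC ipn uz wz).
Qed.

Let dv n : wdiff (v n).
Proof. by move=> z; do 2 eexists; exact: (wirtinger_frame ipl ipC ipn g_free vE dg). Qed.

Let dgn n : wdiff (g n).
Proof. by move=> z; do 2 eexists; exact: dg. Qed.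

Let dS n : wdiff (V := C) (sqnorm ip v n). Proof. exact: wdiff_ip. Qed.

Lemma wdiff_norm_ratio n : wdiff (V := C) (alpha n).
Proof. by apply: (wdiffZ (V := C)) => //; apply: wdiffV => // z; exact: S0. Qed.

Lemma wdiff_subdiag n : wdiff (V := C) (ell n).
Proof. by move=> z; do 2 eexists; exact: (wirtinger_subdiag ipl ipC ipn g_free vE dg). Qed.

(** The z derivative of l_n from [wirtinger_subdiag]; integrating a derivative to 0 asks for its
    continuity, which is checked on this form. *)
Let dell n z := (ip (- prev_ratio ip v n z *: v n.-1 z) (g n.+1 z) +
  ip (v n z) (g n.+2 z)) / sqnorm ip v n z - connection ip g v n z * ell n z.

Let wdiff_dell n : wdiff (V := C) (dell n).
Proof.
apply: (wdiffB (V := C)); apply: (wdiffZ (V := C)).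
- apply: (wdiffD (V := C)); apply: wdiff_ip => //.
  apply: wdiffZ => //; case: n => [|n]; first by rewrite /= oppr0; exact: wdiff_cst.
  have := wdiffB (V := C) (wdiff_cst (0 : C)) (@wdiff_norm_ratio n).
  by under eq_fun do rewrite sub0r.
- by apply: wdiffV => // z; exact: S0.
- apply: (wdiffB (V := C)); first exact: wdiff_subdiag.
  by case: n => [|n]; [exact: wdiff_cst|exact: wdiff_subdiag].
- exact: wdiff_subdiag.
Qed.

Lemma norm_ratio_periodic n l z : lattice w1 w2 l -> alpha n (z + l) = alpha n z.
Proof.
move=> /g_quasi[c [c' [T [c0 dc Tl Ti gT]]]].
exact: (norm_ratio_translation ipl ipC ipn g_free vE dg c0 dc Tl Ti gT).
Qed.

Let a n (p : R * R) := complex.Re (alpha n (toC p)).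

Lemma norm_ratio_integrable n : mu.-integrable D (EFin \o a n).
Proof.
have ca : continuous (a n) := continuous_Re_toC (wdiff_norm_ratio n).
have [|B _ aB] := periodic_bounded w12 ca.
  by move=> l p Ll; rewrite /a toC_translate norm_ratio_periodic.
exact: (bounded_integrable w12 fD (continuous_plane_measurable ca) aB).
Qed.

Let G n z := ell n z - n.+1%:R * ell 0 z.
Let GA n z := dell n z - n.+1%:R * dell 0 z.
Let GB n z := alpha n z - n.+1%:R * alpha 0 z.

Let wdiff_comb (F : nat -> R[i] -> R[i]) n : (forall m, wdiff (V := C) (F m)) ->
  wdiff (V := C) (fun z => F n z - n.+1%:R * F 0 z).
Proof.
move=> dF; apply: (wdiffB (V := C)) => //; apply: (wdiffZ (V := C)) => //.
exact: wdiff_cst.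
Qed.

Let wG n z : wirtinger (V := C) (G n) z (GA n z) (GB n z).
Proof.
have w m := wirtinger_subdiag ipl ipC ipn g_free vE dg m z.
exact: (wirtingerB (w n) (wirtingerZl n.+1%:R (w 0))).
Qed.

Let G_periodic n l z : lattice w1 w2 l -> G n (z + l) = G n z.
Proof.
move=> /g_quasi[c [c' [T [c0 dc Tl Ti gT]]]].
rewrite /G !(subdiag_translation ipl ipC ipn g_free vE dg c0 dc Tl Ti gT).
by rewrite mul1r; ring.
Qed.

Let GA_periodic n l z : lattice w1 w2 l -> GA n (z + l) = GA n z /\ GB n (z + l) = GB n z.
Proof.
move=> Ll; have := wirtinger_shift (wG n (z + l)).
rewrite (_ : (fun z => G n (z + l)) = G n); last first.
  by apply/funext => w; exact: G_periodic.
by move=> /wirtinger_unique /(_ (wG n z)).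
Qed.

(** The derivative of Re (k G) in the real direction d: k = d = 1 gives the x-derivative of Re G,
    and k = -i, d = i the y-derivative of Im G = Re (-i G). *)
Let dir n (k d : R[i]) (p : R * R) : R :=
  complex.Re (d * (k * GA n (toC p)) + d^* * (k * GB n (toC p))).

Let integral_dir n (k d : R[i]) : mu.-integrable D (EFin \o dir n k d) /\
  (\int[mu]_(p in D) (dir n k d p)%:E = 0)%E.
Proof.
have dkF F : wdiff (V := C) F -> wdiff (V := C) (fun z => k * F z).
  by move=> dF; apply: (wdiffZ (V := C)) => //; exact: wdiff_cst.
have cY : continuous (dir n k d).
  apply: (@continuous_Re_toC _ (fun z => d * (k * GA n z) + d^* * (k * GB n z))).
  apply: (wdiffD (V := C)); apply: (wdiffZ (V := C)); try exact: wdiff_cst; apply: dkF.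
    by apply: wdiff_comb; exact: wdiff_dell.
  by apply: wdiff_comb; exact: wdiff_norm_ratio.
have pY l p : lattice w1 w2 l -> dir n k d (translate (ofC l) p) = dir n k d p.
  by move=> Ll; rewrite /dir toC_translate; have [-> ->] := GA_periodic n (toC p) Ll.
have cX : continuous (fun p => complex.Re (k * G n (toC p))).
  apply: (@continuous_Re_toC _ (fun z => k * G n z)); apply: dkF.
  by apply: wdiff_comb; exact: wdiff_subdiag.
split.
  have [B _ YB] := periodic_bounded w12 cY pY.
  exact: (bounded_integrable w12 fD (continuous_plane_measurable cY) YB).
apply: (integral_derivative_periodic w12 fD (d := d) cX cY _ pY).
  by move=> l p Ll; rewrite toC_translate G_periodic.
move=> p t; rewrite /dir toC_translate.
have -> : (fun t : R => complex.Re (k * G n (toC (translate (ofC ((t%:C)%C * d)) p)))) =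
    (fun t : R => complex.Re (k * G n (toC p + (t%:C)%C * d))).
  by apply/funext => t'; rewrite toC_translate.
exact: (wirtinger_is_derive (wirtingerZl k (wG n _))).
Qed.

(* The conj z derivative of the periodic function [ell n - n.+1 * ell 0] is the
   real function [alpha n - n.+1 * alpha 0]: twice its value is the x-derivative
   of the real part minus the y-derivative of the imaginary part. *)
Lemma integral_norm_ratio n :
  (\int[mu]_(p in D) (a n p)%:E = n.+1%:R%:E * \int[mu]_(p in D) (a 0 p)%:E)%E.
Proof.
have mD : measurable (D : set (measurableTypeR R * measurableTypeR R)) := fD.1.
have i0 := norm_ratio_integrable 0.
have [iY1 Y1] := integral_dir n 1 1; have [iY2 Y2] := integral_dir n (- 'i) 'i.
have aE p : a n p = 2^-1 * (dir n 1 1 p - dir n (- 'i) 'i p) + n.+1%:R * a 0 p.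
  rewrite /dir -ReB rmorph1 !mul1r conjCi.
  have ii (x y : R[i]) : 'i * (- 'i * x) + - 'i * (- 'i * y) = x - y.
    have -> : 'i * (- 'i * x) + - 'i * (- 'i * y) = - ('i ^+ 2) * (x - y) by ring.
    by rewrite sqrCi opprK mul1r.
  rewrite ii.
  have -> : GA n (toC p) + GB n (toC p) - (GA n (toC p) - GB n (toC p))
      = ((2 : R)%:C)%C * GB n (toC p) by rewrite rmorph_nat; ring.
  rewrite ReZ mulKf ?pnatr_eq0 // /GB ReB.
  have -> : (n.+1%:R : R[i]) = ((n.+1%:R : R)%:C)%C by rewrite rmorph_nat.
  by rewrite ReZ /a subrK.
transitivity (\int[mu]_(p in D) (2^-1%:E * ((dir n 1 1 p)%:E - (dir n (- 'i) 'i p)%:E)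
    + n.+1%:R%:E * (a 0 p)%:E))%E.
  by apply: eq_integral => p _; rewrite aE EFinD !EFinM EFinB.
have iB := integrableB mD iY1 iY2.
rewrite (@integralD _ _ _ mu D mD); [|exact: integrableZl|exact: integrableZl].
rewrite integralZl // (@integralZl _ _ _ mu D mD _ i0) integralB //.
by rewrite Y1 Y2 sube0 mule0 add0e.
Qed.

(** [b] stands for a_{n-1} with a_{-1} = 0; its integral is n times that of a_0 also at n = 0. The
    integral of a_0 is finite, so [fine] keeps its value. *)
Lemma integral_comb n (x y : R) (b : nat -> R * R -> R) :
  b 0 = (fun=> 0) -> (forall m, b m.+1 = a m) ->
  (\int[mu]_(p in D) (x * a n p + y * b n p)%:E =
   ((x * n.+1%:R + y * n%:R) * fine (\int[mu]_(p in D) (a 0 p)%:E))%:E)%E.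
Proof.
move=> b0 bS.
have mD : measurable (D : set (measurableTypeR R * measurableTypeR R)) := fD.1.
have IE m : (\int[mu]_(p in D) (a m p)%:E =
    (m.+1%:R * fine (\int[mu]_(p in D) (a 0 p)%:E))%:E)%E.
  rewrite integral_norm_ratio EFinM fineK //.
  exact: (integrable_fin_num mD (norm_ratio_integrable 0)).
have [ib bE] : mu.-integrable D (EFin \o b n) /\ (\int[mu]_(p in D) (b n p)%:E =
    (n%:R * fine (\int[mu]_(p in D) (a 0 p)%:E))%:E)%E.
  case: n => [|m]; last by rewrite bS; split; [exact: norm_ratio_integrable|exact: IE].
  by rewrite b0 mul0r; split; [exact: integrable0|exact: integral0].
have ia := norm_ratio_integrable n.
transitivity (\int[mu]_(p in D) (x%:E * (a n p)%:E + y%:E * (b n p)%:E))%E.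
  by apply: eq_integral => p _; rewrite EFinD !EFinM.
rewrite (@integralD _ _ _ mu D mD); [|exact: integrableZl|exact: integrableZl].
rewrite (@integralZl _ _ _ mu D mD _ ia) (@integralZl _ _ _ mu D mD _ ib) bE.
have -> : (\int[mu]_(p in D) (EFin \o a n) p)%E = _ := IE n.
by rewrite -!EFinM -EFinD; congr EFin; ring.
Qed.

End TodaIdentity.

(** * The Landau levels of f and their integrated geometry *)

Section LandauLevels.
Context {R : realType} {H : normedModType R[i]} (ip : H -> H -> R[i]).
Hypothesis ip_inner : inner_product ip.
Variable f : (R[i])^o -> H.
Hypothesis f_holo : holomorphic f.
Hypothesis f_free : derivs_independent f.

Let v n z := dn f n z - Pn ip f n z (dn f n z).
Notation alpha := (norm_ratio ip v).

Let ipl : forall a u v w, ip (a *: u + v) w = a^* * ip u w + ip v w.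
Proof. by case: ip_inner. Qed.
Let ipC : forall u v, ip u v = (ip v u)^*.
Proof. by case: ip_inner. Qed.
Let ipn : forall v, ip v v = `|v| ^+ 2.
Proof. by case: ip_inner. Qed.

Let g_free z n (c : 'I_n.+1 -> R[i]) :
  \sum_(k < n.+1) c k *: dn f k z = 0 -> forall k, c k = 0.
Proof. exact: f_free. Qed.

Let vE n z : v n z = dn f n z - orth_proj ip ((dn f)^~ z) n (dn f n z).
Proof. by []. Qed.

Let dg n z : wirtinger (dn f n) z (dn f n.+1 z) 0.
Proof.
have := wirtinger_derivable (@dn_derivable _ _ _ ipl ipC ipn f f_holo f_free n z).
by rewrite /dn derive1nS.
Qed.

Let b n (p : R * R) : R := if n is m.+1 then complex.Re (alpha m (toC p)) else 0.

Let qgtE n da db z := qgt_frame ipl ipC ipn g_free vE dg n da db z.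

Let Re_prev n p : complex.Re (prev_ratio ip v n (toC p)) = b n p.
Proof. by case: n. Qed.

Lemma trace_metric_LL n p : trace_metric ip (LL ip f n) (toC p) =
  2 * complex.Re (alpha n (toC p)) + 2 * b n p.
Proof.
rewrite /trace_metric !qgtE -Re_prev.
move: (alpha _ _) (prev_ratio _ _ _ _) => [x y] [x' y'].
by rewrite conjC1 /=; ring.
Qed.

Lemma berry_LL n p : berry ip (LL ip f n) (toC p) =
  2 * complex.Re (alpha n (toC p)) + - 2 * b n p.
Proof.
rewrite /berry !qgtE -Re_prev.
move: (alpha _ _) (prev_ratio _ _ _ _) => [x y] [x' y'].
by rewrite conjC1 /=; ring.
Qed.

Variables (w1 w2 : R[i]) (D : set (R * R)).
Hypothesis w12 : lattice_basis w1 w2.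
Hypothesis fD : fundamental_domain (lattice w1 w2) D.
Hypothesis f_quasi : quasi_periodic ip (lattice w1 w2) f.

Let g_quasi l : lattice w1 w2 l -> exists (c c' : R[i] -> R[i]) (T : H -> H),
  [/\ forall z, c z != 0, forall z, wirtinger (V := (R[i])^o) c z (c' z) 0,
    forall a u v, T (a *: u + v) = a *: T u + T v,
    forall u v, ip (T u) (T v) = ip u v &
    forall z, dn f 0 (z + l) = c z *: T (dn f 0 z)].
Proof.
move=> /f_quasi[c [dc [c0 [T [[TL Tip _] fT]]]]].
exists c, (derive1 (c : (R[i])^o -> (R[i])^o)), T; split => // z.
exact: wirtinger_derivable.
Qed.

(** [r] is the integral of a_0 over D; the factors are 2 (n + 1) - 2 n = 2 and 2 (n + 1) + 2 n = 2
    (2 n + 1). One real [r] for all n reduces the theorem to algebra in R. *)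
Lemma intD_LL : exists r : R, forall n,
  intD D (berry ip (LL ip f n)) = (2 * r)%:E /\
  intD D (trace_metric ip (LL ip f n)) = (2 * (2 * n%:R + 1) * r)%:E.
Proof.
have [r IC] : exists r : R, forall n (x y : R),
    intD D (fun z => x * complex.Re (alpha n z) + y * b n (ofC z)) =
    ((x * n.+1%:R + y * n%:R) * r)%:E.
  eexists => n x y; etransitivity; last first.
    exact: (integral_comb ipl ipC ipn g_free vE dg w12 fD g_quasi n x y
      (b := b) erefl (fun=> erefl)).
  by apply: eq_integral => -[p q] _.
exists r => n; split.
  transitivity (intD D (fun z => 2 * complex.Re (alpha n z) + - 2 * b n (ofC z))).
    by apply: eq_integral => -[p q] _; rewrite berry_LL.
  by rewrite IC; congr (_%:E); rewrite -natr1; ring.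
transitivity (intD D (fun z => 2 * complex.Re (alpha n z) + 2 * b n (ofC z))).
  by apply: eq_integral => -[p q] _; rewrite trace_metric_LL.
by rewrite IC; congr (_%:E); rewrite -natr1; ring.
Qed.

End LandauLevels.

Unset Implicit Arguments.

Theorem theorem1 (R : realType) (H : completeNormedModType R[i])
  (ip : H -> H -> R[i]) (f : R[i]^o -> H) (w1 w2 : R[i]) (D : set (R * R)) :
  inner_product ip ->
  @separable_space _ H ->
  lattice_basis w1 w2 ->
  fundamental_domain (lattice w1 w2) D ->
  holomorphic f ->
  derivs_independent f ->
  quasi_periodic ip (lattice w1 w2) f ->
  let Chern := (((2 * pi)^-1)%:E * intD D (berry ip (LL ip f 0)))%E in
  forall n : nat,
    (((2 * pi)^-1)%:E * intD D (berry ip (LL ip f n)))%E = Chern /\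
    (((2 * pi)^-1)%:E * intD D (trace_metric ip (LL ip f n)))%E =
      ((2 * n%:R + 1)%:E * (((2 * pi)^-1)%:E * intD D (berry ip (LL ip f n))))%E /\
    (((2 * pi)^-1)%:E * intD D (trace_metric ip (LL ip f n)))%E =
      ((2 * n%:R + 1)%:E * Chern)%E.
Proof.
move=> ip_inner _ w12 fD f_holo f_free f_quasi /= n.
have [r rE] := intD_LL ip_inner f_holo f_free w12 fD f_quasi.
have [-> ->] := rE n; have [-> _] := rE 0.
by split=> //; split; rewrite -!EFinM; congr EFin; ring.
Qed.
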